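(* Let $n$ be a positive integer and let $X$ be a smooth real $(2n+2)$-dimensional submanifold of the complex space $\mathbb{C}^{n+2}$ such that the image of $X$ under the Gauss map $\sigma : X \to Gr(2n+2,\mathbb{C}^{n+2})$, $\sigma(p)=T_pX$, intersects transversally the subvariety $\mathcal{C}\subset Gr(2n+2,\mathbb{C}^{n+2})$ of those real $(2n+2)$-planes that are complex subspaces of $\mathbb{C}^{n+2}$; that is, for every $p\in X$ with $\sigma(p)\in\mathcal{C}$, one has $d\sigma_p(T_pX)+T_{\sigma(p)}\mathcal{C}=T_{\sigma(p)}Gr(2n+2,\mathbb{C}^{n+2})$. Then the CR-Nash blow-up $\tilde{X}\subset X\times F$ of $X$ is a smooth manifold (i.e. a smooth submanifold of $X\times F$).
   Context: Let $J:\mathbb{C}^{n+2}\to\mathbb{C}^{n+2}$ be the real-linear map given by multiplication by $i$, so $J^2=-I$. The tangent space $T_pX$ of $X$ at $p$ is regarded as a real $(2n+2)$-dimensional linear subspace of $\mathbb{C}^{n+2}\cong\mathbb{R}^{2n+4}$. $Gr(2n+2,\mathbb{C}^{n+2})$ denotes the real Grassmannian of real $(2n+2)$-dimensional linear subspaces of $\mathbb{C}^{n+2}\cong\mathbb{R}^{2n+4}$. The subvariety $\mathcal{C}$ is $$\mathcal{C}=\{\Lambda\in Gr(2n+2,\mathbb{C}^{n+2}) : \Lambda \text{ inherits a complex structure from } \mathbb{C}^{n+2}\},$$ i.e. the set of $\Lambda$ with $J\Lambda=\Lambda$. The complex tangent space of $X$ at $p$ is $H_p=T_pX\cap J(T_pX)$.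 Its real dimension is either $2n$ or $2n+2$. A point $p\in X$ is a complex jump point if $\dim_{\mathbb{R}}H_p=2n+2$. The set of complex jump points of $X$ is denoted $\mathcal{J}$. For $p\in X-\mathcal{J}$, $H_p$ is a complex subspace of $\mathbb{C}^{n+2}$ of complex dimension $n$. The flag manifold $F$ is $$F=\{(\Sigma,\Lambda) : \Sigma\subset\Lambda\subset\mathbb{C}^{n+2}\},$$ where $\Sigma$ ranges over complex $n$-dimensional complex-linear subspaces of $\mathbb{C}^{n+2}$ and $\Lambda$ over real $(2n+2)$-dimensional real-linear subspaces of $\mathbb{C}^{n+2}$. It is a smooth real manifold. The CR-Gauss map is $\tau : X-\mathcal{J}\to F$, $\tau(p)=(H_p,T_pX)$. The CR-Nash blow-up $\tilde{X}$ of $X$ is the closure, in $X\times F$, of the graph $\{(p,\tau(p)) : p\in X-\mathcal{J}\}$ of the CR-Gauss map. *)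

(* Defs.v *)
(* - C^(n+2) is R^(2n+4) = 'rV[R]_(n.+2 + n.+2), the row (x, y) standing for
     x + iy.  Linear maps act on rows from the right.
   - A real linear subspace of R^N is encoded by the orthogonal projector onto
     it: the symmetric idempotent matrix whose row space (in the sense of %MS)
     is the subspace.  This is the standard embedding of the real Grassmannian
     in the Euclidean space 'M[R]_N as a compact smooth submanifold; it provides
     the topology and the smooth structure of Gr(k, R^N), and those of the
     submanifolds C of Gr and F of a product of two Grassmannians.
   - Smooth means C^infinity; submanifolds are embedded. *)
From HB Require Import structures.
From mathcomp Require Import all_boot all_order all_algebra.
From mathcomp Require Import all_classical all_reals all_analysis.

Set Implicit Arguments.
Unset Strict Implicit.
Unset Printing Implicit Defensive.

Import Order.TTheory GRing.Theory Num.Theory.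
Import numFieldNormedType.Exports.

Local Open Scope classical_set_scope.
Local Open Scope ring_scope.

(* For U open and V finite-dimensional, this is the usual class C^k on U: f is
   Frechet differentiable on U and x |-> Df(x).v is C^(k-1) for every v. *)
Fixpoint class_C (R : realType) (V W : normedModType R) (k : nat)
    (U : set V) (f : V -> W) : Prop :=
  if k is k'.+1 then
    (forall x, U x -> differentiable f x) /\
    (forall v, class_C k' U (fun x => 'D_v f x))
  else forall x, U x -> {for x, continuous f}.

Definition smooth_on (R : realType) (V W : normedModType R)
    (U : set V) (f : V -> W) : Prop := forall k, class_C k U f.

(* S is a d-dimensional smooth submanifold of the Euclidean space V: every
   point of S has a relatively open neighbourhood S `&` U in S which is
   diffeomorphic to an open subset B of R^d.  As S need not be open in V, the
   smoothness of the inverse of the parametrization phi is expressed by a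
   smooth extension psi to the open set U of V. *)
Definition smooth_submanifold (R : realType) (V : normedModType R)
    (d : nat) (S : set V) : Prop :=
  forall p, S p ->
    exists (U : set V) (B : set 'rV[R]_d) (phi : 'rV[R]_d -> V)
           (psi : V -> 'rV[R]_d),
      [/\ open U, U p & open B] /\
      [/\ smooth_on B phi, smooth_on U psi,
          phi @` B = S `&` U & forall b, B b -> psi (phi b) = b].

(* For M itself a submanifold of V, the (embedded) submanifolds of M are the
   submanifolds of V contained in M. *)
Definition smooth_submanifold_of (R : realType) (V : normedModType R)
    (M S : set V) : Prop :=
  S `<=` M /\ exists d, smooth_submanifold d S.

Definition curve_at (R : realType) (V : normedModType R)
    (S : set V) (p : V) (c : R -> V) : Prop :=
  c 0 = p /\
  exists I : set R,
    [/\ open I, I 0, smooth_on I c & forall t, I t -> S (c t)].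

Definition tangent_space (R : realType) (V : normedModType R)
    (S : set V) (p : V) : set V :=
  [set v | exists2 c, curve_at S p c & is_derive (0 : R) 1 c v].

(* The image df_p(T_p S), where df_p sends c'(0) to (f \o c)'(0); f is only
   meaningful on S. *)
Definition differential_image (R : realType) (V W : normedModType R)
    (f : V -> W) (S : set V) (p : V) : set W :=
  [set w | exists2 c, curve_at S p c & is_derive (0 : R) 1 (f \o c) w].

Definition orth_projector (R : realType) (N : nat) (P : 'M[R]_N) : Prop :=
  P^T = P /\ P *m P = P.

(* The encoding of a linear subspace E (a junk value if E is not one). *)
Definition encode_subspace (R : realType) (N : nat) (E : set 'rV[R]_N) :
    'M[R]_N :=
  xget 0 [set P | orth_projector P /\ [set v | (v <= P)%MS] = E].

(* encode_subspace does encode every linear subspace, faithfully. *)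
Lemma orth_projector_eq (R : realType) (N : nat) (P Q : 'M[R]_N) :
  orth_projector P -> orth_projector Q ->
  [set v | (v <= P)%MS] = [set v : 'rV_N | (v <= Q)%MS] -> P = Q.
Proof.
suff fix_proj (A B : 'M[R]_N) : orth_projector B ->
    [set v | (v <= A)%MS] `<=` [set v : 'rV_N | (v <= B)%MS] -> A *m B = A.
  move=> hP hQ ePQ; have PQ : P *m Q = P by apply: fix_proj => //; rewrite ePQ.
  have QP : Q *m P = Q by apply: fix_proj => //; rewrite ePQ.
  by rewrite -PQ -[Q in RHS]hQ.1 -[in RHS]QP trmx_mul hP.1 hQ.1.
move=> [_ BB] sAB; have /submxP[D ->] : (A <= B)%MS.
  by apply/row_subP => i; apply: sAB; exact: row_sub.
by rewrite -mulmxA BB.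
Qed.

Lemma orth_projector_exists (R : realType) (m N : nat) (A : 'M[R]_(m, N)) :
  exists2 P : 'M[R]_N, orth_projector P & (P :=: A)%MS.
Proof.
move: (row_base A) (row_base_free A) (eq_row_base A) => B Bfree BA.
pose G := B *m B^T; have GT : G^T = G by rewrite /G trmx_mul trmxK.
have Gu : G \in unitmx.
  rewrite -row_free_unit -kermx_eq0; apply/rowV0P => v /sub_kermxP vG0.
  have : (v *m B) *m (v *m B)^T = 0.
    by rewrite trmx_mul mulmxA -(mulmxA v) vG0 mul0mx.
  move: (v *m B) (mulmx_free_eq0 v Bfree) => w vB0.
  move=> /matrixP/(_ 0 0); rewrite !mxE => /eqP.
  rewrite psumr_eq0 => [/allP w0|i _]; last by rewrite mxE -expr2 sqr_ge0.
  apply/eqP; rewrite -vB0; apply/eqP/rowP => j.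
  have := w0 j (mem_index_enum j).
  by rewrite /= !mxE mulf_eq0 orbb => /eqP.
exists (B^T *m invmx G *m B); last first.
  apply: eqmx_trans BA; apply/eqmxP; rewrite submxMl /=.
  by apply/submxP; exists B; rewrite !mulmxA mulmxV // mul1mx.
split; first by rewrite !trmx_mul trmxK trmx_inv GT mulmxA.
by rewrite !mulmxA -(mulmxA _ B) -/G -(mulmxA _ _ G) mulVmx // mulmx1.
Qed.

Lemma encode_subspaceP (R : realType) (m N : nat) (A : 'M[R]_(m, N)) :
  let P := encode_subspace [set v | (v <= A)%MS] in
  orth_projector P /\ (P :=: A)%MS.
Proof.
move=> P; rewrite {}/P /encode_subspace; case: xgetP => [P _ [hP eP]|].
  split=> //; apply/eqmxP/andP; split; apply/row_subP => i.
    by have := row_sub i P; rewrite -[is_true _]/([set v | (v <= P)%MS] _) eP.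
  by have := row_sub i A; rewrite -[is_true _]/([set v | (v <= A)%MS] _) -eP.
have [P hP PA] := orth_projector_exists A => /(_ P)[]; split=> //.
by apply/seteqP; split=> v /=; rewrite PA.
Qed.

Definition Gr (R : realType) (k N : nat) : set 'M[R]_N :=
  [set P | orth_projector P /\ \rank P = k].
Arguments Gr R k N : clear implicits.

(* Multiplication by i: (x, y) |-> (- y, x). *)
Definition J (R : realType) (n : nat) : 'M[R]_(n.+2 + n.+2) :=
  block_mx 0 1%:M (- 1%:M) 0.

Lemma J_sq (R : realType) (n : nat) : J R n *m J R n = - 1%:M.
Proof.
rewrite /J mulmx_block !(mulmx0, mul0mx, addr0, add0r, mul1mx, mulmx1).
by rewrite [in RHS]scalar_mx_block opp_block_mx !oppr0.
Qed.

(* J Lambda = Lambda *)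
Definition complex_subspace (R : realType) (n : nat)
    (P : 'M[R]_(n.+2 + n.+2)) : Prop := (P *m J R n == P)%MS.

Definition complex_locus (R : realType) (n : nat) :
    set 'M[R]_(n.+2 + n.+2) :=
  [set P | Gr R (2 * n + 2) (n.+2 + n.+2) P /\ complex_subspace P].
Arguments complex_locus R n : clear implicits.

(* Complex dimension n is real dimension 2n for a J-invariant subspace. *)
Definition flag (R : realType) (n : nat) :
    set ('M[R]_(n.+2 + n.+2) * 'M[R]_(n.+2 + n.+2)) :=
  [set SL | [/\ Gr R (2 * n) (n.+2 + n.+2) SL.1, complex_subspace SL.1,
                Gr R (2 * n + 2) (n.+2 + n.+2) SL.2 & (SL.1 <= SL.2)%MS]].
Arguments flag R n : clear implicits.

Definition gauss_map (R : realType) (n : nat)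
    (X : set 'rV[R]_(n.+2 + n.+2)) (p : 'rV[R]_(n.+2 + n.+2)) :
    'M[R]_(n.+2 + n.+2) :=
  encode_subspace (tangent_space X p).

Definition gauss_transversal (R : realType) (n : nat)
    (X : set 'rV[R]_(n.+2 + n.+2)) : Prop :=
  forall p, X p -> complex_locus R n (gauss_map X p) ->
    [set A + B | A in differential_image (gauss_map X) X p
               & B in tangent_space (complex_locus R n) (gauss_map X p)]
    = tangent_space (Gr R (2 * n + 2) (n.+2 + n.+2)) (gauss_map X p).

(* H_p = T_p X `&` J (T_p X) *)
Definition complex_tangent (R : realType) (n : nat)
    (X : set 'rV[R]_(n.+2 + n.+2)) (p : 'rV[R]_(n.+2 + n.+2)) :
    set 'rV[R]_(n.+2 + n.+2) :=
  tangent_space X p `&` [set v *m J R n | v in tangent_space X p].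

Definition complex_jump (R : realType) (n : nat)
    (X : set 'rV[R]_(n.+2 + n.+2)) : set 'rV[R]_(n.+2 + n.+2) :=
  [set p | X p /\ \rank (encode_subspace (complex_tangent X p)) = (2 * n + 2)%N].

Definition cr_gauss_map (R : realType) (n : nat)
    (X : set 'rV[R]_(n.+2 + n.+2)) (p : 'rV[R]_(n.+2 + n.+2)) :
    'M[R]_(n.+2 + n.+2) * 'M[R]_(n.+2 + n.+2) :=
  (encode_subspace (complex_tangent X p), encode_subspace (tangent_space X p)).

(* The closure is taken in X `*` F with its subspace topology. *)
Definition cr_nash_blowup (R : realType) (n : nat)
    (X : set 'rV[R]_(n.+2 + n.+2)) :
    set ('rV[R]_(n.+2 + n.+2) *
         ('M[R]_(n.+2 + n.+2) * 'M[R]_(n.+2 + n.+2))) :=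
  closure [set (p, cr_gauss_map X p) | p in X `\` complex_jump X]
  `&` (X `*` flag R n).

(* Main.v *)
From HB Require Import structures.
Require Import Defs.
From mathcomp Require Import all_boot all_order all_algebra.
From mathcomp Require Import all_classical all_reals all_analysis.
From mathcomp Require Import zify ring lra.

Import Order.TTheory GRing.Theory Num.Theory.
Import numFieldNormedType.Exports.

Local Open Scope classical_set_scope.
Local Open Scope ring_scope.

(** The blow-up consists of all the triples (p, S, T_pX) in which S is a
    complex n-dimensional subspace of T_pX.  Over a point where T_pX is not
    complex there is only one such S; near a complex jump point, the claim is
    that these triples form the blow-up of C^(n+1) at the origin.

    Let p0 be a jump point, L0 its tangent plane and e a unit normal vector,
    so that the normal plane of L0 is the complex line spanned by e.  The normal
    plane of a nearby real plane L is the graph over that line of a real-linear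
    map into L0, which splits into a C-linear part A and an antilinear part, and
    the latter is determined by one vector b of L0: the normal plane of L is
    { z (e + A) + conj(z) b : z in C }.  Hence L is complex exactly when b = 0, and
    in general the smallest complex space containing the normal plane is
    C (e + A) + C b.  The map L |-> b (here [defect], which is 2b; [lead] is
    e + A + b) thus cuts out the complex planes, near L0, by n + 1 complex
    equations; transversality says that p |-> b(T_pX), a map from a
    (2n+2)-dimensional manifold to C^(n+1), has an invertible differential at
    p0 ([defect_jacobian_unit]).  By the inverse function theorem b is a
    local coordinate system of X centred at p0.

    A complex n-plane S is contained in L if and only if its orthogonal, a
    complex plane of complex dimension 2, contains e + A and b.  Near a
    given S0, with g a unit vector of L0 orthogonal to S0, that
    orthogonal is spanned over C by e + A + b and a unique vector g + v with
    v in S0; so the condition becomes that b = t (g + v) for a complex number t.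
    Therefore (v, t) are coordinates of the space of triples
    ([blowup_plane], [blowup_plane_inv]): the usual affine chart of a
    blow-up.  The points with t <> 0 are dense and lie over regular points, so
    the whole chart lies in the closure ([jump_chart_parametrizes]).

    The inverse function theorem for C^infinity maps is derived from the
    contraction principle, over a calculus of the classes C^k that is closed
    under composition, matrix products and matrix inverses. *)

Set Implicit Arguments.
Unset Strict Implicit.
Unset Printing Implicit Defensive.

(** * Frechet derivatives *)

Section Differentiability.
Context {R : realType}.
Implicit Types V W : normedModType R.

Lemma differentiable_epsilonP V W (f : V -> W) (L : {linear V -> W}) x :
  continuous L ->
  (forall e, 0 < e -> \forall h \near 0, `|f (h + x) - f x - L h| <= e * `|h|) ->
  differentiable f x /\ 'd f x = L :> (V -> W).
Proof.
move=> cL fL; have fE : f \o shift x = cst (f x) + L +o_ 0 id.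
  by apply/eqaddoP => e e0; apply: filterS (fL e e0) => h /=; rewrite !fctE opprD addrA.
have dfE := diff_unique cL fE; split => //.
by apply/diff_locallyP; rewrite dfE.
Qed.

Lemma near_eq_differentiable V W (f g : V -> W) x :
  (\forall y \near x, f y = g y) -> differentiable f x -> differentiable g x.
Proof.
move=> fg df; have [cdf dfE] := (diff_locallyP _ _).1 df.
apply: (@differentiable_epsilonP _ _ _ ('d f x) _ _ _).1 => // e e0.
have /eqaddoP/(_ e e0) := dfE; rewrite !near_simpl => near_f.
have fg0 : \forall h \near 0, f (h + x) = g (h + x).
  have /= := fg; rewrite -{1}(add0r x) => fg1.
  by apply: (cvgD cvg_id (cvg_cst x)) fg1.
near=> h; rewrite -(near fg0 h) // -(nbhs_singleton fg).
have : `|(f \o shift x - (cst (f x) + 'd f x)) h| <= e * `|id h| by near: h.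
by rewrite !fctE /= opprD addrA.
Unshelve. all: by end_near. Qed.

Lemma derive_comp_linear V1 V2 V3 (f : V1 -> V2) (L : {linear V2 -> V3}) x v :
  continuous L -> differentiable f x -> 'D_v (L \o f) x = L ('D_v f x).
Proof.
move=> cL df; have dL y : differentiable L y by exact: linear_differentiable.
have dLf : differentiable (L \o f) x by exact: differentiable_comp.
by rewrite (deriveE _ dLf) (deriveE _ df) diff_comp //= diff_lin.
Qed.

Lemma derive_linear_comp V1 V2 V3 (L : {linear V1 -> V2}) (f : V2 -> V3) x v :
  continuous L -> differentiable f (L x) ->
  'D_v (fun y => f (L y)) x = 'D_(L v) f (L x).
Proof.
move=> cL df; have dL y : differentiable L y by exact: linear_differentiable.
have dfL : differentiable (fun y => f (L y)) x by exact: differentiable_comp (dL x) df.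
by rewrite (deriveE _ dfL) (deriveE _ df) [in LHS](diff_comp (dL x) df) /= diff_lin.
Qed.

Lemma derive_comp_mx V W m n (g : 'M[R]_(m, n) -> W) (f : V -> 'M[R]_(m, n)) x v :
  differentiable f x -> differentiable g (f x) ->
  'D_v (g \o f) x =
    \sum_i \sum_j 'D_v (fun y => f y i j) x *: 'D_(delta_mx i j) g (f x).
Proof.
move=> df dg; have dgf : differentiable (g \o f) x by exact: differentiable_comp.
rewrite (deriveE _ dgf) diff_comp //= -(deriveE _ df).
rewrite [X in 'd _ _ X]matrix_sum_delta !linear_sum.
apply: eq_bigr => i _; rewrite linear_sum; apply: eq_bigr => j _.
rewrite linearZ -(deriveE _ dg); congr (_ *: _).
rewrite derive_mx ?mxE //; exact: diff_derivable.
Qed.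

Lemma is_derive_curve V W (c : R -> V) (g : V -> W) (t : R) (v : V) :
  is_derive t (1 : R) c v -> differentiable g (c t) ->
  is_derive t (1 : R) (g \o c) ('D_v g (c t)).
Proof.
move=> [dc <-] dg; have /derivable1_diffP dct := dc.
have dgc : differentiable (g \o c) t by exact: differentiable_comp.
apply: DeriveDef; first exact/derivable1_diffP.
by rewrite (deriveE _ dgc) (deriveE _ dg) (deriveE _ dct) diff_comp.
Qed.

Lemma is_derive_unique V W (f : V -> W) x v a b :
  is_derive x v f a -> is_derive x v f b -> a = b.
Proof. by move=> [_ <-] [_ <-]. Qed.

End Differentiability.

(** * Maps of class C^k *)

Section ClassC.
Context {R : realType}.
Implicit Types V W : normedModType R.

(** [class_C] constrains the global function [f] only through its values near
    points of [U]; openness of [U] is what makes its derivatives local too. *)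
Lemma class_C_ext V W k (U : set V) (f g : V -> W) : open U ->
  (forall x, U x -> f x = g x) -> class_C k U f -> class_C k U g.
Proof.
move=> oU; elim: k f g => [|k IH] f g fg /= => [cf x Ux|[df Df]].
  have nfg : \forall y \near x, f y = g y.
    by apply: filterS (open_nbhs_nbhs (conj oU Ux)).
  rewrite /prop_for /continuous_at -(fg x Ux).
  by apply: cvg_trans (cf x Ux); apply: near_eq_cvg; apply: filterS nfg => y ->.
have nfg x : U x -> \forall y \near x, f y = g y.
  by move=> Ux; apply: filterS (open_nbhs_nbhs (conj oU Ux)).
split=> [x Ux|v]; first by apply: near_eq_differentiable (df x Ux); exact: nfg.
by apply: IH (Df v) => x Ux; apply: near_eq_derive; exact: nfg.
Qed.

Lemma class_CW V W k (U : set V) (f : V -> W) : class_C k.+1 U f -> class_C k U f.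
Proof.
elim: k f => [|k IH] f [df Df] => [x Ux|].
  exact/differentiable_continuous/df.
by split=> // v; exact: IH.
Qed.

Lemma class_C_continuous V W k (U : set V) (f : V -> W) x :
  class_C k U f -> U x -> {for x, continuous f}.
Proof. by elim: k => [|k IH] fC; [exact: fC|apply/IH/class_CW]. Qed.

Lemma class_C_sub V W k (U U' : set V) (f : V -> W) :
  U' `<=` U -> class_C k U f -> class_C k U' f.
Proof.
move=> sU; elim: k f => [|k IH] f /= => [cf x /sU|[df Df]]; first exact: cf.
by split=> [x /sU|v]; [exact: df|exact: IH].
Qed.

Lemma class_C_cst V W k (U : set V) (a : W) : class_C k U (fun=> a).
Proof.
elim: k a => [|k IH] a /=; first by move=> x _; exact: cst_continuous.
split=> [x _|v]; first exact: differentiable_cst.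
have -> : 'D_v (fun=> a : W) = (fun=> 0) by apply/funext => x; exact: derive_cst.
exact: IH.
Qed.

Lemma class_CD V W k (U : set V) (f g : V -> W) : open U ->
  class_C k U f -> class_C k U g -> class_C k U (fun x => f x + g x).
Proof.
move=> oU; elim: k f g => [|k IH] f g /= => [cf cg x Ux|[df Df] [dg Dg]].
  by apply: cvgD; [exact: cf|exact: cg].
split=> [x Ux|v]; first by apply: differentiableD; [exact: df|exact: dg].
apply: class_C_ext (IH _ _ (Df v) (Dg v)) => // x Ux.
by rewrite deriveD //; apply: diff_derivable; [exact: df|exact: dg].
Qed.

Lemma class_C_sum V W k (U : set V) (I : Type) (r : seq I) (P : pred I)
    (f : I -> V -> W) : open U ->
  (forall i, P i -> class_C k U (f i)) ->
  class_C k U (fun x => \sum_(i <- r | P i) f i x).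
Proof.
move=> oU fC; elim: r => [|i r IH].
  by apply: class_C_ext (class_C_cst _ _ 0) => // x _; rewrite big_nil.
have [Pi|Pi] := boolP (P i).
  apply: class_C_ext (class_CD oU (fC i Pi) IH) => // x _.
  by rewrite big_cons Pi.
by apply: class_C_ext IH => // x _; rewrite big_cons (negbTE Pi).
Qed.

Lemma class_C_comp_linear V1 V2 V3 k (U : set V1) (f : V1 -> V2)
    (L : {linear V2 -> V3}) : open U -> continuous L ->
  class_C k U f -> class_C k U (fun x => L (f x)).
Proof.
move=> oU cL; elim: k f => [|k IH] f /= => [cf x Ux|[df Df]].
  by apply: continuous_comp; [exact: cf|exact: cL].
split=> [x Ux|v].
  by apply: differentiable_comp (linear_differentiable _ cL); exact: df.
apply: class_C_ext (IH _ (Df v)) => // x Ux.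
by rewrite -[RHS]/('D_v (L \o f) x) derive_comp_linear //; exact: df.
Qed.

Lemma class_C_linear_comp V1 V2 V3 k (U : set V2) (U' : set V1)
    (L : {linear V1 -> V2}) (f : V2 -> V3) : open U' -> continuous L ->
  (forall x, U' x -> U (L x)) ->
  class_C k U f -> class_C k U' (fun x => f (L x)).
Proof.
move=> oU cL LU; elim: k f => [|k IH] f /= => [cf x Ux|[df Df]].
  by apply: continuous_comp; [exact: cL|exact/cf/LU].
split=> [x /LU Ux|v].
  by apply: differentiable_comp (linear_differentiable _ cL) _; exact: df.
apply: class_C_ext (IH _ (Df (L v))) => // x /LU Ux.
by rewrite -[RHS]/('D_v (fun y => f (L y)) x) derive_linear_comp //; exact: df.
Qed.

Lemma class_CZl V W k (U : set V) (f : V -> R) (w : W) : open U ->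
  class_C k U f -> class_C k U (fun x => f x *: w).
Proof.
move=> oU fC; have lin : linear (fun a : R => a *: w).
  by move=> a b c; rewrite scalerDl scalerA.
pose L : {linear R -> W} :=
  HB.pack (fun a : R => a *: w) (GRing.isLinear.Build _ _ _ _ _ lin).
exact: (@class_C_comp_linear _ _ _ _ _ _ L oU (@scalel_continuous _ _ w)).
Qed.

Lemma class_CM V k (U : set V) (f g : V -> R) : open U ->
  class_C k U f -> class_C k U g -> class_C k U (fun x => f x * g x).
Proof.
move=> oU; elim: k f g => [|k IH] f g => [cf cg x Ux|fC gC].
  by apply: cvgM; [exact: cf|exact: cg].
have [[df Df] [dg Dg]] := (fC, gC).
split=> [x Ux|v]; first by apply: differentiableM; [exact: df|exact: dg].
apply: class_C_ext (class_CD oU (IH _ _ (class_CW fC) (Dg v))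
  (IH _ _ (class_CW gC) (Df v))) => // x Ux.
by rewrite deriveM //; apply: diff_derivable; [exact: df|exact: dg].
Qed.

Lemma class_C_prod V k (U : set V) (I : Type) (r : seq I) (P : pred I)
    (f : I -> V -> R) : open U ->
  (forall i, P i -> class_C k U (f i)) ->
  class_C k U (fun x => \prod_(i <- r | P i) f i x).
Proof.
move=> oU fC; elim: r => [|i r IH].
  by apply: class_C_ext (class_C_cst _ _ (1 : R)) => // x _; rewrite big_nil.
have [Pi|Pi] := boolP (P i).
  apply: class_C_ext (class_CM oU (fC i Pi) IH) => // x _.
  by rewrite big_cons Pi.
by apply: class_C_ext IH => // x _; rewrite big_cons (negbTE Pi).
Qed.

Lemma class_CV V k (U : set V) (f : V -> R) : open U ->
  (forall x, U x -> f x != 0) -> class_C k U f -> class_C k U (fun x => (f x)^-1).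
Proof.
move=> oU f0; elim: k => [|k IH] => [cf x Ux|fC].
  by apply: cvgV; [exact: f0|exact: cf].
have [df Df] := fC; have fVC := IH (class_CW fC).
split=> [x Ux|v]; first by apply: differentiableV; [exact: df|exact: f0].
have := class_CM oU (class_CM oU (class_C_cst k U (- 1 : R))
  (class_CM oU fVC fVC)) (Df v).
apply: class_C_ext => // x Ux.
rewrite deriveV ?f0 //; last exact/diff_derivable/df.
by rewrite expr2 invfM mulN1r.
Qed.

Lemma class_C_pair V W1 W2 k (U : set V) (f : V -> W1) (g : V -> W2) : open U ->
  class_C k U f -> class_C k U g -> class_C k U (fun x => (f x, g x)).
Proof.
move=> oU; elim: k f g => [|k IH] f g /= => [cf cg x Ux|[df Df] [dg Dg]].
  by apply: cvg_pair; [exact: cf|exact: cg].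
split=> [x Ux|v]; first by apply: differentiable_pair; [exact: df|exact: dg].
apply: class_C_ext (IH _ _ (Df v) (Dg v)) => // x Ux.
have dfg := differentiable_pair (df x Ux) (dg x Ux).
rewrite (deriveE _ dfg) (deriveE _ (df x Ux)) (deriveE _ (dg x Ux)).
by rewrite diff_pair //; [exact: df|exact: dg].
Qed.

Lemma class_C_mxP V m n k (U : set V) (f : V -> 'M[R]_(m, n)) : open U ->
  class_C k U f <-> forall i j, class_C k U (fun x => f x i j).
Proof.
move=> oU; split=> [fC i j|fC].
  have lin : linear (fun M : 'M[R]_(m, n) => M i j) by move=> a A B; rewrite !mxE.
  pose L : {linear 'M[R]_(m, n) -> R} :=
    HB.pack (fun M : 'M[R]_(m, n) => M i j) (GRing.isLinear.Build _ _ _ _ _ lin).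
  exact: (@class_C_comp_linear _ _ _ _ _ _ L oU (@coord_continuous _ _ _ i j)).
apply: (@class_C_ext _ _ _ _ (fun x => \sum_i \sum_j f x i j *: delta_mx i j)) => //.
  by move=> x _; rewrite -matrix_sum_delta.
apply: class_C_sum => // i _; apply: class_C_sum => // j _; exact: class_CZl.
Qed.

(** By induction on [k]: the chain rule writes a directional derivative of the
    composite as a finite sum of products of functions of class C^(k-1), because
    the derivatives of [g] can be taken in the constant basis directions. *)
Lemma class_C_comp V m n p q k (U : set V) (U' : set 'M[R]_(m, n))
    (f : V -> 'M[R]_(m, n)) (g : 'M[R]_(m, n) -> 'M[R]_(p, q)) :
  open U -> open U' -> (forall x, U x -> U' (f x)) ->
  class_C k U f -> class_C k U' g -> class_C k U (fun x => g (f x)).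
Proof.
move=> oU oU' fU fC /class_C_mxP-/(_ oU') gC; apply/class_C_mxP => // i j.
suff comp (h : 'M[R]_(m, n) -> R) :
    class_C k U' h -> class_C k U (fun x => h (f x)) by exact: comp (gC i j).
elim: k h fC {i j g gC} => [|k IH] g fC gC => [x Ux|].
  by apply: continuous_comp; [exact: fC|exact/gC/fU].
have [[df Df] [dg Dg]] := (fC, gC).
split=> [x Ux|v].
  by apply: differentiable_comp; [exact: df|exact/dg/fU].
have sC : class_C k U (fun x =>
    \sum_i \sum_j 'D_v f x i j * 'D_(delta_mx i j) g (f x)).
  apply: class_C_sum => // i _; apply: class_C_sum => // j _.
  apply: class_CM => //; first by have /class_C_mxP := Df v; exact.
  exact: IH (class_CW fC) (Dg _).
apply: class_C_ext sC => // x Ux.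
rewrite [RHS]derive_comp_mx; [|exact: df|exact/dg/fU].
apply: eq_bigr => i _; apply: eq_bigr => j _; congr (_ * _).
by rewrite derive_mx ?mxE //; exact/diff_derivable/df.
Qed.

Lemma class_CMmx V m n p k (U : set V) (f : V -> 'M[R]_(m, n))
    (g : V -> 'M[R]_(n, p)) : open U ->
  class_C k U f -> class_C k U g -> class_C k U (fun x => f x *m g x).
Proof.
move=> oU /(class_C_mxP _ _ oU) fC /(class_C_mxP _ _ oU) gC.
apply/class_C_mxP => // i j.
have sC : class_C k U (fun x => \sum_l f x i l * g x l j).
  by apply: class_C_sum => // l _; exact: class_CM.
by apply: class_C_ext sC => // x _; rewrite mxE.
Qed.

Lemma class_C_tr V m n k (U : set V) (f : V -> 'M[R]_(m, n)) : open U ->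
  class_C k U f -> class_C k U (fun x => (f x)^T).
Proof.
move=> oU /(class_C_mxP _ _ oU) fC; apply/class_C_mxP => // i j.
by apply: class_C_ext (fC j i) => // x _; rewrite mxE.
Qed.

Lemma class_C_det V n k (U : set V) (f : V -> 'M[R]_n) : open U ->
  class_C k U f -> class_C k U (fun x => \det (f x)).
Proof.
move=> oU /(class_C_mxP _ _ oU) fC; apply: class_C_sum => // s _.
apply: class_CM => //; first exact: class_C_cst.
exact: class_C_prod.
Qed.

(** Cramer's rule: the entries of the inverse are rational in those of the
    matrix. *)
Lemma class_C_inv V n k (U : set V) (f : V -> 'M[R]_n) : open U ->
  (forall x, U x -> f x \in unitmx) ->
  class_C k U f -> class_C k U (fun x => invmx (f x)).
Proof.
move=> oU fU fC; have fC' := (class_C_mxP _ _ oU).1 fC.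
apply/class_C_mxP => // i j.
suff eC : class_C k U (fun x => (\det (f x))^-1 * cofactor (f x) j i).
  by apply: class_C_ext eC => // x Ux; rewrite /invmx fU // !mxE.
apply: class_CM => //.
  apply: class_CV => //; last exact: class_C_det.
  by move=> x /fU; rewrite unitmxE unitfE.
apply: class_CM => //; first exact: class_C_cst.
apply: class_C_det => //; apply/class_C_mxP => // a b.
by apply: class_C_ext (fC' (lift j a) (lift i b)) => // x _; rewrite !mxE.
Qed.

Lemma class_C_row_mx V m n1 n2 k (U : set V) (f : V -> 'M[R]_(m, n1))
    (g : V -> 'M[R]_(m, n2)) : open U ->
  class_C k U f -> class_C k U g -> class_C k U (fun x => row_mx (f x) (g x)).
Proof.
move=> oU /(class_C_mxP _ _ oU) fC /(class_C_mxP _ _ oU) gC.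
apply/class_C_mxP => // i j; case: (split_ordP j) => l ->.
  by apply: class_C_ext (fC i l) => // x _; rewrite row_mxEl.
by apply: class_C_ext (gC i l) => // x _; rewrite row_mxEr.
Qed.

Lemma class_C_col_mx V m1 m2 n k (U : set V) (f : V -> 'M[R]_(m1, n))
    (g : V -> 'M[R]_(m2, n)) : open U ->
  class_C k U f -> class_C k U g -> class_C k U (fun x => col_mx (f x) (g x)).
Proof.
move=> oU fC gC.
have := class_C_tr oU (class_C_row_mx oU (class_C_tr oU fC) (class_C_tr oU gC)).
by apply: class_C_ext => // x _; rewrite tr_row_mx !trmxK.
Qed.

Lemma class_C_usubmx V m1 m2 m k (U : set V) (A : V -> 'M[R]_(m1 + m2, m)) :
  open U -> class_C k U A -> class_C k U (fun x => usubmx (A x)).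
Proof.
move=> oU /(class_C_mxP _ _ oU) AC; apply/class_C_mxP => // i j.
by apply: class_C_ext (AC (lshift m2 i) j) => // x _; rewrite mxE.
Qed.

Lemma class_C_dsubmx V m1 m2 m k (U : set V) (A : V -> 'M[R]_(m1 + m2, m)) :
  open U -> class_C k U A -> class_C k U (fun x => dsubmx (A x)).
Proof.
move=> oU /(class_C_mxP _ _ oU) AC; apply/class_C_mxP => // i j.
by apply: class_C_ext (AC (rshift m1 i) j) => // x _; rewrite mxE.
Qed.

Lemma class_C_lsubmx V m m1 m2 k (U : set V) (A : V -> 'M[R]_(m, m1 + m2)) :
  open U -> class_C k U A -> class_C k U (fun x => lsubmx (A x)).
Proof.
move=> oU /(class_C_mxP _ _ oU) AC; apply/class_C_mxP => // i j.
by apply: class_C_ext (AC i (lshift m2 j)) => // x _; rewrite mxE.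
Qed.

Lemma class_C_rsubmx V m m1 m2 k (U : set V) (A : V -> 'M[R]_(m, m1 + m2)) :
  open U -> class_C k U A -> class_C k U (fun x => rsubmx (A x)).
Proof.
move=> oU /(class_C_mxP _ _ oU) AC; apply/class_C_mxP => // i j.
by apply: class_C_ext (AC i (rshift m1 j)) => // x _; rewrite mxE.
Qed.

Lemma class_C_fst V1 V2 W k (U : set V1) (U' : set (V1 * V2)) (f : V1 -> W) :
  open U' -> (forall q, U' q -> U q.1) ->
  class_C k U f -> class_C k U' (fun q => f q.1).
Proof.
move=> oU' sU fC; pose L : {linear (V1 * V2)%type -> V1} := fst.
have cL : continuous L by move=> q; exact: cvg_fst.
exact: (class_C_linear_comp oU' cL sU fC).
Qed.

Lemma class_C_snd V1 V2 W k (U : set V2) (U' : set (V1 * V2)) (f : V2 -> W) :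
  open U' -> (forall q, U' q -> U q.2) ->
  class_C k U f -> class_C k U' (fun q => f q.2).
Proof.
move=> oU' sU fC; pose L : {linear (V1 * V2)%type -> V2} := snd.
have cL : continuous L by move=> q; exact: cvg_snd.
exact: (class_C_linear_comp oU' cL sU fC).
Qed.

Lemma class_CB V W k (U : set V) (f g : V -> W) : open U ->
  class_C k U f -> class_C k U g -> class_C k U (fun x => f x - g x).
Proof.
move=> oU fC gC; apply: class_CD => //.
pose L : {linear W -> W} := *:%R (- 1).
have LC : class_C k U (fun x => L (g x)).
  by apply: class_C_comp_linear => //; exact: scaler_continuous.
by apply: class_C_ext LC => // x _ /=; rewrite scaleN1r.
Qed.

Lemma class_C_id V k (U : set V) : class_C k U id.
Proof.
case: k => [|k] /=; first by move=> x _; exact: cvg_id.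
split=> [x _|v]; first by apply: ex_diff; exact: is_diff_id.
have -> : 'D_v (id : V -> V) = (fun=> v) by apply/funext => x; exact: derive_id.
exact: class_C_cst.
Qed.

Lemma class_C_open V W k (U : set V) (U' : set W) (f : V -> W) :
  open U -> open U' -> class_C k U f -> open [set x | U x /\ U' (f x)].
Proof.
move=> oU oU' fC; rewrite openE => x [Ux fx]; rewrite /interior.
have cf := class_C_continuous fC Ux.
have nU : nbhs x U by exact: open_nbhs_nbhs.
have nU' : nbhs x (f @^-1` U') by apply: cf; exact: open_nbhs_nbhs.
exact: filterI.
Qed.

Lemma open_unitmx n : open [set A : 'M[R]_n | A \in unitmx].
Proof.
have := @class_C_open _ _ 0 [set: 'M[R]_n] [set a : R | a != 0] (fun A => \det A).
rewrite (_ : [set x | _] = [set A : 'M[R]_n | A \in unitmx]).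
  apply; first exact: openT.
    exact: open_neq.
  by apply: class_C_det; [exact: openT|exact: class_C_id].
by apply/seteqP; split => A /=; rewrite unitmxE unitfE // => -[].
Qed.

Lemma closure_eq (T : topologicalType) W (S : set T) (f g : T -> W) (p : T) :
  closure S p -> (\forall q \near p, S q -> f q = g q) ->
  {for p, continuous f} -> {for p, continuous g} -> f p = g p.
Proof.
move=> Sp fg cf cg; apply: (@norm_hausdorff _ W) => A B fA gB.
have [|q [Sq [[Aq Bq] fgq]]] :=
  Sp ((f @^-1` A `&` g @^-1` B) `&` [set q | S q -> f q = g q]).
  by apply: filterI fg; apply: filterI; [exact: cf|exact: cg].
by exists (f q); split=> //; rewrite fgq.
Qed.

End ClassC.
(** * The inverse function theorem *)

Section MeanValue.
Context {R : realType}.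

Lemma coord_norm_le m n (A : 'M[R]_(m, n)) i j : `|A i j| <= `|A|.
Proof.
rewrite [leRHS]/Num.Def.normr /= mx_normrE.
exact: (le_bigmax _ (fun ij : 'I_m * 'I_n => `|A ij.1 ij.2|) (i, j)).
Qed.

Lemma norm_le_coord m n (A : 'M[R]_(m, n)) e :
  0 <= e -> (forall i j, `|A i j| <= e) -> `|A| <= e.
Proof.
move=> e0 Ae; rewrite [leLHS]/Num.Def.normr /= mx_normrE.
by apply: bigmax_le => // -[i j] _.
Qed.

Lemma jacobianE m n (f : 'rV[R]_m -> 'rV[R]_n) x i j :
  differentiable f x -> jacobian f x i j = 'D_(delta_mx 0 i) f x 0 j.
Proof. move=> df; rewrite deriveEjacobian // -rowE. by rewrite !mxE. Qed.

(** For the sup norm, the one-variable mean value theorem can be applied to each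
    coordinate separately, along the segment from [y] to [x]. *)
Lemma mean_value_ball m n (f : 'rV[R]_m -> 'rV[R]_n) (c : 'rV[R]_m) (r e : R) :
  0 <= e ->
  (forall x : 'rV[R]_m, ball c r x -> differentiable f x) ->
  (forall (x : 'rV[R]_m) i j, ball c r x -> `|jacobian f x i j| <= e) ->
  forall x y : 'rV[R]_m, ball c r x -> ball c r y ->
    `|f x - f y| <= m%:R * e * `|x - y|.
Proof.
move=> e0 df Je x y cx cy; apply: norm_le_coord => [|i j].
  by rewrite !mulr_ge0.
rewrite (ord1 i) {i}.
pose g (t : R) := y + t *: (x - y).
have cg (t : R) : t \in `[0, 1]%R -> ball c r (g t).
  rewrite in_itv /= => /andP[t0 t1].
  move: cx cy; rewrite -ball_normE /ball_ /= => cx cy.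
  have -> : c - g t = t *: (c - x) + (1 - t) *: (c - y).
    by apply/rowP => k; rewrite !mxE; ring.
  rewrite (le_lt_trans (ler_normD _ _)) // !normrZ !ger0_norm // ?subr_ge0 //.
  have [->|tn0] := eqVneq t 0; first by rewrite mul0r add0r subr0 mul1r.
  have t_gt0 : 0 < t by rewrite lt0r tn0.
  have := mulr_gt0 t_gt0 (etrans (subr_gt0 _ _) cx).
  have := mulr_ge0 (etrans (subr_ge0 _ _) t1) (ltW (etrans (subr_gt0 _ _) cy)).
  by nra.
have dg (t : R) : is_diff t g (fun s => s *: (x - y)).
  by apply: is_diff_eq; rewrite add0r.
pose h (t : R) := f (g t) 0 j.
have dh (t : R) : t \in `[0, 1]%R ->
    is_derive t 1 h (((x - y) *m jacobian f (g t)) 0 j).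
  move=> /cg cgt; have dft := df _ cgt.
  have dfg : differentiable (f \o g) t by apply: differentiable_comp.
  have -> : (x - y) *m jacobian f (g t) = 'D_1 (f \o g) t.
    rewrite deriveE // diff_comp //= -deriveEjacobian // deriveE // diff_val /=.
    by rewrite scale1r.
  rewrite derive_mx; last exact: diff_derivable.
  rewrite mxE; apply: derivableP.
  by have /derivable_mxP := @diff_derivable _ _ _ _ _ (1 : R) dfg; exact.
have [|t tI hE] := @MVT R h _ 0 1 ltr01 (fun t tI => dh t (subset_itv_oo_cc tI)).
  apply: derivable_within_continuous => s /dh hs.
  exact: ex_derive.
have -> : (f x - f y) 0 j = h 1 - h 0.
  by rewrite !mxE /h /g scale1r scale0r addr0 subrKC.
rewrite hE subr0 mulr1 mxE.
rewrite (le_trans (ler_norm_sum _ _ _)) //.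
apply: (@le_trans _ _ (\sum_(i < m) e * `|x - y|)).
  apply: ler_sum => i _; rewrite normrM mulrC ler_pM //; last exact: coord_norm_le.
  exact/Je/cg/subset_itv_oo_cc.
by rewrite sumr_const card_ord -mulrA mulr_natl.
Qed.

End MeanValue.

Section InverseFunction.
Context {R : realType} {d : nat}.
#[local] HB.instance Definition _ := Complete.on 'rV[R]_d.

Lemma class_C_jacobian m n k (U : set 'rV[R]_m) (f : 'rV[R]_m -> 'rV[R]_n) :
  open U -> class_C k.+1 U f -> class_C k U (fun x => jacobian f x).
Proof.
move=> oU [df Df]; apply/class_C_mxP => // i j.
have /class_C_mxP-/(_ oU 0 j) := Df (delta_mx 0 i).
by apply: class_C_ext => // x Ux; rewrite jacobianE //; exact: df.
Qed.

Lemma open_ball_sub (V : normedModType R) (U : set V) x :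
  open U -> U x -> exists2 r : R, 0 < r & ball x r `<=` U.
Proof.
by move=> oU Ux; have /nbhs_ballP[r r0 rU] := open_nbhs_nbhs (conj oU Ux); exists r.
Qed.

Lemma continuous_mulmxr m n (M : 'M[R]_(m, n)) :
  continuous (mulmxr M : 'rV[R]_m -> 'rV[R]_n).
Proof.
have MC : class_C 0 [set: 'rV[R]_m] (fun v => v *m M).
  by apply: class_CMmx; [exact: openT|exact: class_C_id|exact: class_C_cst].
by move=> v; exact: (class_C_continuous MC).
Qed.

Lemma norm_mulmx_bound m n (M : 'M[R]_(m, n)) :
  exists2 C : R, 0 < C & forall v : 'rV[R]_m, `|v *m M| <= C * `|v|.
Proof.
by have [C C0 CM] := linear_lipschitz (@continuous_mulmxr m n M); exists C.
Qed.

(** If [x - F x] is a contraction, then [F x = y] is the fixed point equation of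
    the contraction [x |-> y + (x - F x)], which maps the closed ball of radius
    [r / 2] into itself when [y] is within [r / 4] of [F x0]. *)
Lemma inverse_function_bilipschitz (F : 'rV[R]_d -> 'rV[R]_d) x0 (r : R) : 0 < r ->
  (forall x y, ball x0 r x -> ball x0 r y ->
     `|(x - F x) - (y - F y)| <= 2^-1 * `|x - y|) ->
  (forall x y, ball x0 r x -> ball x0 r y -> `|x - y| <= 2 * `|F x - F y|) /\
  (forall y, ball (F x0) (r / 4) y -> exists2 x, ball x0 r x & F x = y).
Proof.
move=> r0 Fr; split=> [x y bx bY|y Fy].
  have := ler_normD ((x - F x) - (y - F y)) (F x - F y).
  have -> : (x - F x) - (y - F y) + (F x - F y) = x - y.
    by apply/rowP => i; rewrite !mxE; ring.
  have := Fr _ _ bx bY; lra.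
pose C := closed_ball_ Num.norm x0 (r / 2).
have Cr x : C x -> ball x0 r x.
  rewrite -ball_normE /C /closed_ball_ /ball_ /=; lra.
have x0r : ball x0 r x0 by exact: ballxx.
pose T x := y + (x - F x).
have TC : {homo T : x / C x >-> C x}.
  move=> x /[dup] /Cr bx Cx; rewrite /C /closed_ball_ /=.
  have -> : x0 - T x = ((x0 - F x0) - (x - F x)) + (F x0 - y).
    by rewrite /T; apply/rowP => i; rewrite !mxE; ring.
  have := ler_normD ((x0 - F x0) - (x - F x)) (F x0 - y).
  have := Fr _ _ x0r bx; move: Fy Cx.
  rewrite -ball_normE /C /closed_ball_ /ball_ /=; lra.
have cT : is_contraction (mkfun_fun TC).
  exists (2^-1)%:nng; split; first by rewrite /=; lra.
  move=> [u v] [/Cr bu /Cr bv] /=.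
  have -> : T u - T v = (u - F u) - (v - F v).
    by rewrite /T; apply/rowP => i; rewrite !mxE; ring.
  exact: Fr.
have [||x Cx xT] := banach_fixed_point cT.
- exact: closed_closed_ball_.
- by exists x0; rewrite /C /closed_ball_ /= subrr normr0; lra.
exists x; first exact: Cr.
have : x = y + (x - F x) by exact: xT.
move=> /(congr1 (fun z => z - x + F x)); rewrite subrr add0r => ->.
by apply/rowP => i; rewrite !mxE; ring.
Qed.

(** [h] is only assumed to be a local right inverse of [F] that is Lipschitz at
    [y]: this bounds the remainder of [F] at [h y], which is a little-o of
    [h (k + y) - h y], by a little-o of [k]. *)
Lemma differentiable_inverse (F h : 'rV[R]_d -> 'rV[R]_d) (y : 'rV[R]_d) (c : R) :
  0 < c ->
  differentiable F (h y) -> jacobian F (h y) \in unitmx ->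
  (\forall k \near (0 : 'rV[R]_d),
     F (h (k + y)) = k + y /\ `|h (k + y) - h y| <= c * `|k|) ->
  differentiable h y /\ forall v, 'D_v h y = v *m invmx (jacobian F (h y)).
Proof.
move=> c0 dF Ju hk; set J := jacobian F (h y) in Ju *; set x := h y in dF J Ju hk *.
have Fx : F x = y by have [] := nbhs_singleton hk; rewrite !add0r.
have [C C0 JC] := norm_mulmx_bound (invmx J).
have [||dh hE] := @differentiable_epsilonP _ _ _ h (mulmxr (invmx J)) y.
- exact: continuous_mulmxr.
- move=> e e0; have e'0 : 0 < e / (C * c) by rewrite divr_gt0 ?mulr_gt0.
  have [_ /eqaddoP/(_ _ e'0)/nbhs_normP[/= r r0 Fr]] := (diff_locallyP _ _).1 dF.
  have rc0 : 0 < r / c by rewrite divr_gt0.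
  have kr0 : \forall k \near (0 : 'rV[R]_d), `|k| < r / c.
    by apply/nbhs_normP; exists (r / c) => //= z; rewrite /= sub0r normrN.
  apply: filterS2 hk kr0 => k [Fh hle] kr.
  have dr : `|h (k + y) - x| < r by rewrite (le_lt_trans hle) // mulrC -ltr_pdivlMr.
  have := Fr (h (k + y) - x); rewrite /= sub0r normrN => /(_ dr).
  rewrite !fctE /= subrK Fh Fx -deriveE // deriveEjacobian // -/J.
  have -> : k + y - (y + (h (k + y) - x) *m J) = k - (h (k + y) - x) *m J.
    by apply/rowP => i; rewrite !mxE; ring.
  move=> ok; rewrite -/x.
  have -> : h (k + y) - x - k *m invmx J = - ((k - (h (k + y) - x) *m J) *m invmx J).
    by rewrite mulmxBl mulmxK // opprB.
  rewrite normrN (le_trans (JC _)) //.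
  apply: (@le_trans _ _ (C * (e / (C * c) * (c * `|k|)))).
    rewrite ler_pM2l // (le_trans ok) // ler_pM2l //.
  rewrite le_eqVlt; apply/orP; left; apply/eqP; field.
  by rewrite !gt_eqF.
by split=> // v; rewrite deriveE // hE.
Qed.

(** The differential being the identity at [x0], [x - F x] is a contraction near
    [x0]. The inverse gains one derivative at a time, as its derivative
    is the inverse matrix of the Jacobian of [F] at the inverse. *)
Lemma inverse_function_id (U : set 'rV[R]_d) (F : 'rV[R]_d -> 'rV[R]_d) x0 :
  open U -> U x0 -> smooth_on U F -> jacobian F x0 = 1%:M ->
  exists (B1 V1 : set 'rV[R]_d) (h : 'rV[R]_d -> 'rV[R]_d),
    [/\ open B1, B1 x0, B1 `<=` U & open V1] /\
    [/\ smooth_on V1 h, forall x, B1 x -> V1 (F x), forall x, B1 x -> h (F x) = x,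
        forall y, V1 y -> B1 (h y) & forall y, V1 y -> F (h y) = y].
Proof.
move=> oU Ux0 FC J1.
have JC k : class_C k U (fun x => jacobian F x) by exact: class_C_jacobian.
have dF x : U x -> differentiable F x by exact: (FC 1).1.
(* d e <= 1 / 2; the successor avoids a division by 0 in dimension 0. *)
pose e := (2 * d.+1%:R)^-1 : R.
have e0 : 0 < e by rewrite invr_gt0 mulr_gt0.
pose near1 := [set A : 'M[R]_d | A \in unitmx] `&` ball (1%:M : 'M[R]_d) e.
have onear1 : open near1.
  by apply: openI; [exact: open_unitmx|exact: ball_open].
have [||r r0 rU] := @open_ball_sub _ [set x | U x /\ near1 (jacobian F x)] x0.
- exact: class_C_open oU onear1 (JC 0%N).
- split=> //; rewrite J1; split; [exact: unitmx1|exact: ballxx].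
pose G x := x - F x.
have dG x : U x -> differentiable G x by move=> /dF ?; exact: differentiableB.
have JG x i j : U x -> jacobian G x i j = (1%:M - jacobian F x) i j.
  move=> Ux; rewrite (jacobianE _ _ (dG x Ux)).
  rewrite [RHS]mxE [X in _ + X]mxE (jacobianE _ _ (dF x Ux)).
  rewrite deriveB //; [|exact: diff_derivable (dF x Ux)].
  by rewrite derive_id !mxE eqxx eq_sym.
have [|lip surj] := @inverse_function_bilipschitz F x0 r r0.
  move=> x y bx b_y; apply: (@le_trans _ _ (d%:R * e * `|x - y|)).
    apply: (@mean_value_ball R d d G x0 r e (ltW e0)) => //
      [z /rU[Uz _]|z i j /rU[Uz [_ near1z]]].
      exact: dG.
    rewrite JG //; apply: le_trans (coord_norm_le _ _ _) _.
    by move: near1z; rewrite -ball_normE /= => /ltW.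
  apply: ler_wpM2r => //; rewrite /e invfM mulrCA ler_piMr ?invr_ge0 //.
  by rewrite ler_pdivrMr // mul1r ler_nat.
pose V1 := ball (F x0) (r / 4).
have r40 : 0 < r / 4 by rewrite divr_gt0.
have oV1 : open V1 by exact: ball_open.
pose B1 := [set x | ball x0 r x /\ V1 (F x)].
have bU : ball x0 r `<=` U by move=> x /rU[].
have FCb k : class_C k (ball x0 r) F by exact: class_C_sub (FC k).
have oball : open (ball x0 r) by exact: ball_open.
have oB1 : open B1 by exact: class_C_open oball oV1 (FCb 0%N).
have [h hV1] : exists h : 'rV[R]_d -> 'rV[R]_d,
    forall y, V1 y -> ball x0 r (h y) /\ F (h y) = y.
  have /(_ _)/cid2 hex : forall y, exists2 x, V1 y -> ball x0 r x & V1 y -> F x = y.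
    move=> y; have [Vy|nVy] := pselect (V1 y); last by exists y.
    by have [x bx Fx] := surj y Vy; exists x.
  exists (fun y => s2val (hex y)) => y Vy.
  by case: (hex y) => /= x bx Fx; split; [exact: bx|exact: Fx].
have hB1 y : V1 y -> B1 (h y).
  by move=> Vy; have [bh Fh] := hV1 y Vy; split => //; rewrite Fh.
have hF x : B1 x -> h (F x) = x.
  move=> [bx Vx]; have [bh Fh] := hV1 _ Vx.
  have := lip _ _ bh bx; rewrite Fh subrr normr0 mulr0 normr_le0 subr_eq0.
  by move=> /eqP.
have hdiff y : V1 y -> differentiable h y /\
    forall v, 'D_v h y = v *m invmx (jacobian F (h y)).
  move=> Vy; have [bh Fh] := hV1 y Vy; have [Uh [Ju _]] := rU _ bh.
  apply: (@differentiable_inverse F h y 2) => //; first exact: dF.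
  have nV : \forall k \near (0 : 'rV[R]_d), V1 (k + y).
    have := open_nbhs_nbhs (conj oV1 Vy); rewrite -{1}(add0r y) => nV.
    exact: (cvgD cvg_id (cvg_cst y)) nV.
  apply: filterS nV => k Vk; have [bhk Fhk] := hV1 _ Vk; split=> //.
  by rewrite (le_trans (lip _ _ bhk bh)) // Fhk Fh addrK.
have hC : smooth_on V1 h.
  elim=> [|k IH].
    by move=> y /hdiff[dh _]; exact: differentiable_continuous.
  split=> [y /hdiff[]//|v].
  have DC : class_C k V1 (fun y => v *m invmx (jacobian F (h y))).
    apply: class_CMmx => //; first exact: class_C_cst.
    apply: class_C_inv => // [y /hV1[/rU[_ []]]//|].
    apply: (@class_C_comp _ _ _ _ _ _ _ V1 U) => //.
    by move=> y /hV1[/bU].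
  by apply: class_C_ext DC => // y /hdiff[_ ->].
exists B1, V1, h; split; split=> //.
- by split; [exact: ballxx|exact: ballxx].
- by move=> x [/bU].
- by move=> x [].
- by move=> y /hV1[].
Qed.

Theorem inverse_function (U : set 'rV[R]_d) (f : 'rV[R]_d -> 'rV[R]_d) x0 :
  open U -> U x0 -> smooth_on U f -> jacobian f x0 \in unitmx ->
  exists (B1 V1 : set 'rV[R]_d) (h : 'rV[R]_d -> 'rV[R]_d),
    [/\ open B1, B1 x0, B1 `<=` U & open V1] /\
    [/\ smooth_on V1 h, forall x, B1 x -> V1 (f x), forall x, B1 x -> h (f x) = x,
        forall y, V1 y -> B1 (h y) & forall y, V1 y -> f (h y) = y].
Proof.
move=> oU Ux0 fC Ju; pose A := jacobian f x0; pose F x := f x *m invmx A.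
have FC : smooth_on U F by move=> k; apply: class_CMmx => //; exact: class_C_cst.
have JF : jacobian F x0 = 1%:M.
  apply/row_matrixP => i; rewrite [LHS]rowE -deriveEjacobian; last exact: (FC 1).1.
  rewrite [LHS](@derive_comp_linear _ _ _ _ f (mulmxr (invmx A))).
  - by rewrite /= deriveEjacobian -?mulmxA ?mulmxV -?rowE //; exact: (fC 1).1.
  - exact: continuous_mulmxr.
  - exact: (fC 1).1.
have [B1 [V1 [h [[oB1 B1x0 B1U oV1] [hC FV hF hB Fh]]]]] :=
  inverse_function_id oU Ux0 FC JF.
have lC k (W : set 'rV[R]_d) : open W -> class_C k W (fun y => y *m invmx A).
  by move=> oW; apply: class_CMmx => //; [exact: class_C_id|exact: class_C_cst].
pose V2 := [set y | [set: 'rV[R]_d] y /\ V1 (y *m invmx A)].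
have oV2 : open V2 by exact: class_C_open openT oV1 (lC 0%N _ openT).
exists B1, V2, (fun y => h (y *m invmx A)); split; split=> //.
- move=> k; apply: (@class_C_comp _ _ _ _ _ _ _ V2 V1) => //; last exact: lC.
  by move=> y [].
- by move=> x B1x; split=> //; exact: FV.
- by move=> y [_ /hB].
- by move=> y [_ /Fh/(congr1 (mulmxr A))]; rewrite /F /= -!mulmxA mulVmx // !mulmx1.
Qed.

End InverseFunction.
(** * Orthogonal projectors *)

Section Projectors.
Context {R : realType}.

Lemma row_dot_eq0 N (v : 'rV[R]_N) : v *m v^T = 0 -> v = 0.
Proof.
move=> /matrixP/(_ 0 0); rewrite !mxE => /eqP.
rewrite psumr_eq0 => [/allP v0|i _]; last by rewrite mxE -expr2 sqr_ge0.
apply/rowP => j; have := v0 j (mem_index_enum j).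
by rewrite /= !mxE mulf_eq0 orbb => /eqP.
Qed.

Lemma gram_unit r N (A : 'M[R]_(r, N)) : row_free A -> A *m A^T \in unitmx.
Proof.
move=> Af; rewrite -row_free_unit -kermx_eq0; apply/rowV0P => v /sub_kermxP vG0.
apply/eqP; rewrite -(mulmx_free_eq0 v Af); apply/eqP/row_dot_eq0.
by rewrite trmx_mul mulmxA -(mulmxA v) vG0 mul0mx.
Qed.

(** The orthogonal projector onto the row space of [A], in closed form so as to
    depend smoothly on [A]. *)
Definition span_proj r N (A : 'M[R]_(r, N)) := A^T *m invmx (A *m A^T) *m A.

Lemma span_projP r N (A : 'M[R]_(r, N)) : row_free A ->
  orth_projector (span_proj A) /\ (span_proj A :=: A)%MS.
Proof.
move=> /gram_unit Gu; split; last first.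
  apply/eqmxP; rewrite submxMl /=.
  by apply/submxP; exists A; rewrite /span_proj !mulmxA mulmxV // mul1mx.
split; first by rewrite /span_proj !trmx_mul trmxK trmx_inv trmx_mul trmxK mulmxA.
by rewrite /span_proj !mulmxA -(mulmxA _ A) -(mulmxA _ _ (A *m A^T)) mulVmx // mulmx1.
Qed.

Lemma eqmx_orth_projector N (P Q : 'M[R]_N) :
  orth_projector P -> orth_projector Q -> (P :=: Q)%MS -> P = Q.
Proof.
move=> hP hQ PQ; apply: orth_projector_eq => //.
by apply/seteqP; split=> v /=; rewrite PQ.
Qed.

Lemma orth_projector_sub r N (P : 'M[R]_N) (A : 'M[R]_(r, N)) :
  orth_projector P -> (A <= P)%MS = (A *m P == A).
Proof.
move=> [_ PP]; apply/idP/eqP => [/submxP[B ->]|<-]; last exact: submxMl.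
by rewrite -mulmxA PP.
Qed.

Lemma orth_projectorC N (P : 'M[R]_N) :
  orth_projector P -> orth_projector (1%:M - P).
Proof.
move=> [PT PP]; split; first by rewrite linearB /= trmx1 PT.
by rewrite mulmxBl mul1mx mulmxBr mulmx1 PP subrr subr0.
Qed.

Lemma orth_projector_subC r N (P : 'M[R]_N) (A : 'M[R]_(r, N)) :
  orth_projector P -> (A <= 1%:M - P)%MS = (A *m P == 0).
Proof.
move=> hP; rewrite orth_projector_sub; last exact: orth_projectorC.
by rewrite mulmxBr mulmx1 -[X in _ == X]subr0 (inj_eq (addrI _)) eqr_opp.
Qed.

Lemma rank_orth_projectorC N (P : 'M[R]_N) :
  orth_projector P -> \rank (1%:M - P) = (N - \rank P)%N.
Proof.
move=> hP; have PP := hP.2.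
have : (kermx P :=: 1%:M - P)%MS.
  apply/eqmxP/andP; split.
    by rewrite orth_projector_subC // mulmx_ker.
  by apply/sub_kermxP; rewrite mulmxBl mul1mx PP subrr.
by move=> <-; rewrite mxrank_ker.
Qed.

Lemma orth_projectorCS N (P Q : 'M[R]_N) :
  orth_projector P -> orth_projector Q -> (P <= Q)%MS -> (1%:M - Q <= 1%:M - P)%MS.
Proof.
move=> hP hQ; rewrite orth_projector_sub // => /eqP PQ.
have QP : Q *m P = P by rewrite -[in LHS]hP.1 -[in LHS]hQ.1 -trmx_mul PQ hP.1.
by rewrite orth_projector_subC // mulmxBl mul1mx QP subrr.
Qed.

Lemma exists_unit_row r N (A : 'M[R]_(r, N)) : (0 < \rank A)%N ->
  exists2 v : 'rV[R]_N, (v <= A)%MS & v *m v^T = 1%:M.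
Proof.
rewrite lt0n mxrank_eq0 => A0; have [i Ai] : exists i, row i A != 0.
  apply/existsP; apply: contraR A0; rewrite negb_exists => /forallP A0.
  by apply/eqP/row_matrixP => i; rewrite row0; apply/eqP; rewrite -[_ == _]negbK A0.
pose w := row i A; pose q := (w *m w^T) 0 0.
have q0 : 0 < q.
  rewrite lt0r; apply/andP; split.
    apply: contraNneq Ai => q0; apply/eqP/row_dot_eq0.
    by apply/matrixP => a b; rewrite !ord1 [LHS]q0 mxE.
  by rewrite /q mxE sumr_ge0 // => j _; rewrite !mxE -expr2 sqr_ge0.
exists ((Num.sqrt q)^-1 *: w); first exact/scalemx_sub/row_sub.
rewrite linearZ /= -scalemxAl -scalemxAr scalerA (mx11_scalar (w *m w^T)) -/q.
by rewrite -invfM -expr2 sqr_sqrtr ?ltW // scale_scalar_mx mulVf // gt_eqF.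
Qed.

(** When the row space of [M] is the graph of a map over that of [D], with respect
    to the orthogonal decomposition, this is the basis of the graph lying over
    the basis [D] (for orthonormal [D]). *)
Definition graph_basis r N (D : 'M[R]_(r, N)) (M : 'M[R]_N) : 'M[R]_(r, N) :=
  invmx (D *m M *m D^T) *m (D *m M).

Section GraphBasis.
Variables (r N : nat) (D : 'M[R]_(r, N)) (M : 'M[R]_N).
Hypothesis Mu : D *m M *m D^T \in unitmx.

Lemma graph_basis_dual : graph_basis D M *m D^T = 1%:M.
Proof. by rewrite /graph_basis -(mulmxA (invmx _)) mulVmx. Qed.

Lemma graph_basis_sub : (graph_basis D M <= M)%MS.
Proof. by rewrite /graph_basis mulmxA; exact: submxMl. Qed.

Lemma graph_basis_free : row_free (graph_basis D M).
Proof. by apply/row_freeP; exists D^T; exact: graph_basis_dual. Qed.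

Hypothesis rM : \rank M = r.

Lemma graph_basis_eqmx : (graph_basis D M :=: M)%MS.
Proof.
apply/eqmxP; rewrite -mxrank_leqif_eq ?graph_basis_sub //.
by rewrite rM; have := graph_basis_free; rewrite /row_free => /eqP ->.
Qed.

(** A vector of a graph is determined by its projection to the base. *)
Lemma graph_basis_inj p (v : 'M[R]_(p, N)) :
  (v <= M)%MS -> v = v *m D^T *m graph_basis D M.
Proof.
rewrite -graph_basis_eqmx => /submxP[y ->].
by rewrite -(mulmxA y) graph_basis_dual mulmx1.
Qed.

End GraphBasis.

Lemma dual_row_free r N (D W : 'M[R]_(r, N)) : W *m D^T \in unitmx -> row_free W.
Proof.
move=> Wu; apply/row_freeP; exists (D^T *m invmx (W *m D^T)).
by rewrite mulmxA mulmxV.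
Qed.

Lemma span_proj_dual r N (D W : 'M[R]_(r, N)) :
  W *m D^T \in unitmx -> D *m span_proj W *m D^T \in unitmx.
Proof.
move=> Wu; have Gu := gram_unit (dual_row_free Wu).
have -> : D *m span_proj W *m D^T =
    (W *m D^T)^T *m invmx (W *m W^T) *m (W *m D^T).
  by rewrite /span_proj trmx_mul trmxK !mulmxA.
by rewrite !unitmx_mul unitmx_tr unitmx_inv Wu Gu.
Qed.

Lemma graph_basis_span_proj r N (D W : 'M[R]_(r, N)) :
  W *m D^T = 1%:M -> graph_basis D (span_proj W) = W.
Proof.
move=> W1; have Wu : W *m D^T \in unitmx by rewrite W1 unitmx1.
have [hP PW] := span_projP (dual_row_free Wu).
rewrite [RHS](@graph_basis_inj _ _ D (span_proj W)) ?W1 ?mul1mx ?PW //.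
  exact: span_proj_dual.
by apply/eqP; exact: dual_row_free Wu.
Qed.

Lemma orth_sub_mul0 r1 r2 N (P : 'M[R]_N) (A : 'M[R]_(r1, N)) (B : 'M[R]_(r2, N)) :
  orth_projector P -> (A <= P)%MS -> (B <= 1%:M - P)%MS -> A *m B^T = 0.
Proof.
move=> hP; rewrite orth_projector_sub // => /eqP <-.
rewrite orth_projector_subC // => /eqP BP.
by rewrite -mulmxA -{1}hP.1 -trmx_mul BP trmx0 mulmx0.
Qed.

Lemma exists_row_basis r m N (A : 'M[R]_(m, N)) : \rank A = r ->
  exists2 B : 'M[R]_(r, N), row_free B & (B :=: A)%MS.
Proof.
by move=> <-; exists (row_base A); [exact: row_base_free|exact: eq_row_base].
Qed.

Implicit Type V : normedModType R.

Lemma class_C_span_proj V r N k (U : set V) (A : V -> 'M[R]_(r, N)) : open U ->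
  (forall x, U x -> row_free (A x)) ->
  class_C k U A -> class_C k U (fun x => span_proj (A x)).
Proof.
move=> oU Af AC; have ATC := class_C_tr oU AC.
apply: class_CMmx => //; apply: class_CMmx => //.
apply: class_C_inv => //; last exact: class_CMmx.
by move=> x /Af; exact: gram_unit.
Qed.

Lemma class_C_graph_basis V r N k (U : set V) (D : 'M[R]_(r, N)) (M : V -> 'M[R]_N) :
  open U -> (forall x, U x -> D *m M x *m D^T \in unitmx) ->
  class_C k U M -> class_C k U (fun x => graph_basis D (M x)).
Proof.
move=> oU Mu MC.
have DC : class_C k U (fun x => D *m M x).
  by apply: class_CMmx => //; exact: class_C_cst.
apply: class_CMmx => //; apply: class_C_inv => //.
by apply: class_CMmx => //; exact: class_C_cst.
Qed.

Definition graph_locus r N (D : 'M[R]_(r, N)) : set 'M[R]_N :=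
  [set P | D *m (1%:M - P) *m D^T \in unitmx].

Lemma open_graph_locus r N (D : 'M[R]_(r, N)) : open (graph_locus D).
Proof.
have LC : class_C 0 [set: 'M[R]_N] (fun P => D *m (1%:M - P) *m D^T).
  apply: class_CMmx; [exact: openT| |exact: class_C_cst].
  apply: class_CMmx; [exact: openT|exact: class_C_cst|].
  by apply: class_CB; [exact: openT|exact: class_C_cst|exact: class_C_id].
have := class_C_open openT (@open_unitmx R r) LC.
rewrite (_ : [set x | _] = graph_locus D) //.
by apply/seteqP; split=> P // [].
Qed.

End Projectors.

(** * The complex structure *)

Section ComplexStructure.
Context {R : realType} {n : nat}.
Local Notation N := (n.+2 + n.+2)%N.
Local Notation J := (J R n).
Implicit Types P Q : 'M[R]_N.

Lemma trJ : J^T = - J.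
Proof.
by rewrite /Defs.J tr_block_mx !trmx0 trmx1 linearN /= trmx1 opp_block_mx !oppr0 opprK.
Qed.

Lemma JJ r (A : 'M[R]_(r, N)) : A *m J *m J = - A.
Proof. by rewrite -mulmxA J_sq mulmxN mulmx1. Qed.

Lemma stableJ_eqmx r (A : 'M[R]_(r, N)) : (A *m J <= A)%MS -> (A *m J :=: A)%MS.
Proof.
move=> AJ; apply/eqmxP; rewrite AJ /=.
by have := submxMr J AJ; rewrite JJ eqmx_opp.
Qed.

Lemma complex_subspaceE P : complex_subspace P <-> (P *m J <= P)%MS.
Proof.
by split=> [/andP[]//|PJ]; apply/eqmxP/stableJ_eqmx.
Qed.

(** [J] is skew-symmetric. *)
Lemma stableJ_C P : orth_projector P -> (P *m J <= P)%MS ->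
  ((1%:M - P) *m J <= 1%:M - P)%MS.
Proof.
move=> hP; rewrite orth_projector_sub // => /eqP PJP.
rewrite orth_projector_subC //; apply/eqP.
have := congr1 trmx PJP; rewrite !trmx_mul trJ hP.1 mulNmx mulmxN => /oppr_inj PJP'.
by rewrite mulmxBl mul1mx mulmxBl -mulmxA PJP' subrr.
Qed.

(** In a basis of the subspace, [J] is a square matrix [C] with [C *m C = - 1],
    whose determinant has the square (-1)^rank. *)
Lemma stableJ_even r (A : 'M[R]_(r, N)) : (A *m J <= A)%MS -> ~~ odd (\rank A).
Proof.
move=> AJ; pose B := row_base A.
have /submxP[C BC] : (B *m J <= B)%MS.
  by rewrite (eqmxMr J (eq_row_base A)) eq_row_base.
have CC : C *m C = - 1%:M.
  apply: (row_free_inj (row_base_free A)); rewrite -mulmxA -BC mulmxA -BC JJ.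
  by rewrite mulNmx mul1mx.
have := congr1 determinant CC; rewrite det_mulmx -scaleN1r detZ det1 mulr1 => CE.
apply/negP => odd_r; have := sqr_ge0 (\det C).
by rewrite expr2 CE -signr_odd odd_r expr1 oppr_ge0 ler10.
Qed.

(** A real basis of the complex line through [v]; a row [t] of length 2 is the
    complex number by which [t *m cspan v] multiplies [v]. *)
Definition cspan (v : 'rV[R]_N) : 'M[R]_(1 + 1, N) := col_mx v (v *m J).

(** The matrix of [J] in the basis [cspan v]. *)
Definition iota2 : 'M[R]_(1 + 1) := block_mx 0 1%:M (- 1%:M) 0.

Lemma cspanJ v : cspan v *m J = iota2 *m cspan v.
Proof.
rewrite /cspan mul_col_mx JJ /iota2 mul_block_col !mul0mx add0r addr0 mul1mx.
by rewrite mulNmx mul1mx.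
Qed.

Lemma cspan_stable v : (cspan v *m J <= cspan v)%MS.
Proof. by rewrite cspanJ submxMl. Qed.

Lemma cspan_sub r (A : 'M[R]_(r, N)) v :
  (A *m J <= A)%MS -> (v <= A)%MS -> (cspan v <= A)%MS.
Proof.
move=> AJ vA; rewrite /cspan col_mx_sub vA /=.
exact: submx_trans (submxMr J vA) AJ.
Qed.

Lemma mulJ_cspan_tr r (A : 'M[R]_(r, N)) e :
  A *m J *m (cspan e)^T = - (A *m (cspan e)^T *m iota2^T).
Proof. by rewrite -!mulmxA -!trmx_mul -cspanJ trmx_mul trJ mulNmx mulmxN opprK. Qed.

Lemma cspan_dual0 v e : v *m (cspan e)^T = 0 -> cspan v *m (cspan e)^T = 0.
Proof.
by move=> ve; rewrite {1}/cspan mul_col_mx mulJ_cspan_tr ve mul0mx oppr0 col_mx0.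
Qed.

Lemma cspan_dual1 v e :
  v *m (cspan e)^T = row_mx 1%:M 0 -> cspan v *m (cspan e)^T = 1%:M.
Proof.
move=> ve; rewrite {1}/cspan mul_col_mx mulJ_cspan_tr ve.
rewrite /iota2 tr_block_mx mul_row_block.
rewrite !mul0mx !mul1mx !addr0 !trmx0 linearN /= trmx1 opp_row_mx opprK oppr0.
by rewrite [RHS]scalar_mx_block.
Qed.

Lemma cspan_unit e : e *m e^T = 1%:M -> cspan e *m (cspan e)^T = 1%:M.
Proof.
move=> ee; apply: cspan_dual1.
rewrite /cspan tr_col_mx mul_mx_row ee; congr (row_mx _ _).
rewrite trmx_mul trJ mulNmx mulmxN; apply/eqP; rewrite oppr_eq0; apply/eqP.
have : (e *m (J *m e^T))^T = - (e *m (J *m e^T)).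
  by rewrite !trmx_mul trmxK trJ mulmxN mulNmx mulmxA.
rewrite mulmxA; move: (e *m J *m e^T) => q /matrixP/(_ 0 0); rewrite !mxE => qE.
by apply/matrixP => i j; rewrite !ord1 mxE; lra.
Qed.

End ComplexStructure.
(** * Real planes near a complex plane *)

Section Defect.
Context {R : realType} {n : nat}.
Local Notation N := (n.+2 + n.+2)%N.
Local Notation J := (J R n).
Local Notation K := (2 * n + 2)%N.
Implicit Types (P S : 'M[R]_N) (e v w : 'rV[R]_N).

Lemma orth_complement_sub r s m (D : 'M[R]_(r, m)) (A : 'M[R]_(s, m)) :
  row_free D -> row_free A -> A *m D^T = 0 -> (r + s)%N = m ->
  forall p (v : 'M[R]_(p, m)), v *m D^T = 0 -> (v <= A)%MS.
Proof.
move=> Df Af AD rs p v vD; have [hM MD] := span_projP Df.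
have subC q (w : 'M[R]_(q, m)) : w *m D^T = 0 -> (w <= 1%:M - span_proj D)%MS.
  by move=> wD; rewrite orth_projector_subC // /span_proj !mulmxA wD !mul0mx.
apply: submx_trans (subC _ v vD) _.
rewrite -(geq_leqif (mxrank_leqif_sup (subC _ A AD))).
by rewrite rank_orth_projectorC // MD (eqP Df) (eqP Af) -rs addKn.
Qed.

Lemma sub_col_mxu m1 m2 m (A : 'M[R]_(m1, m)) (B : 'M[R]_(m2, m)) :
  (A <= col_mx A B)%MS.
Proof. by rewrite -addsmxE addsmxSl. Qed.

Lemma sub_col_mxd m1 m2 m (A : 'M[R]_(m1, m)) (B : 'M[R]_(m2, m)) :
  (B <= col_mx A B)%MS.
Proof. by rewrite -addsmxE addsmxSr. Qed.

Lemma usubmx_sub m1 m2 m (A : 'M[R]_(m1 + m2, m)) : (usubmx A <= A)%MS.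
Proof. by rewrite -{2}[A]vsubmxK; exact: sub_col_mxu. Qed.

Lemma dsubmx_sub m1 m2 m (A : 'M[R]_(m1 + m2, m)) : (dsubmx A <= A)%MS.
Proof. by rewrite -{2}[A]vsubmxK; exact: sub_col_mxd. Qed.

(** The normal plane of [P] is the graph { z (e + A) + conj(z) b } over the complex
    line of [e]; the basis vectors of that graph lying over [e] and [e *m J] are
    [e + A + b] and [(e + A - b) *m J]. So [lead] is [e + A + b] and [defect] is
    [2 b]. *)
Definition lead e P : 'rV[R]_N := usubmx (graph_basis (cspan e) (1%:M - P)).

Definition defect e P : 'rV[R]_N :=
  lead e P + dsubmx (graph_basis (cspan e) (1%:M - P)) *m J.

Section DefectProps.
Variables (e : 'rV[R]_N) (P : 'M[R]_N).
Hypothesis Pu : cspan e *m (1%:M - P) *m (cspan e)^T \in unitmx.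

Lemma lead_dual : lead e P *m (cspan e)^T = row_mx 1%:M 0.
Proof.
rewrite /lead mul_usub_mx graph_basis_dual //.
by rewrite [X in usubmx X]scalar_mx_block /block_mx col_mxKu.
Qed.

(** Over the complex line of [e], the two basis vectors of the graph project to [e]
    and [e *m J], and [J] maps the latter to [- e]. *)
Lemma defect_dual : defect e P *m (cspan e)^T = 0.
Proof.
rewrite /defect mulmxDl lead_dual mulJ_cspan_tr mul_dsub_mx graph_basis_dual //.
rewrite [X in dsubmx X]scalar_mx_block /block_mx col_mxKd.
rewrite /iota2 tr_block_mx mul_row_block.
rewrite !mul0mx !mul1mx !add0r !trmx0 trmx1 opp_row_mx oppr0.
by rewrite add_row_mx subrr addr0 row_mx0.
Qed.

Lemma lead_sub : (lead e P <= 1%:M - P)%MS.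
Proof. exact: submx_trans (usubmx_sub (graph_basis _ _)) (graph_basis_sub _ _). Qed.

Lemma defect_sub r (A : 'M[R]_(r, N)) : (A *m J <= A)%MS ->
  (1%:M - P <= A)%MS -> (defect e P <= A)%MS.
Proof.
move=> AJ PA; have GA := submx_trans (graph_basis_sub (cspan e) _) PA.
apply: addmx_sub; first exact: (submx_trans (usubmx_sub _) GA).
by apply: submx_trans (submxMr J _) AJ; exact: (submx_trans (dsubmx_sub _) GA).
Qed.

Hypothesis rP : \rank (1%:M - P) = 2.

(** The second basis vector of the graph is [(lead e P - defect e P) *m J]. *)
Lemma normal_sub r (A : 'M[R]_(r, N)) : (A *m J <= A)%MS ->
  (lead e P <= A)%MS -> (defect e P <= A)%MS -> (1%:M - P <= A)%MS.
Proof.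
move=> AJ lA dA; rewrite -(graph_basis_eqmx Pu rP).
rewrite -[graph_basis _ _]vsubmxK col_mx_sub lA /=.
have -> : dsubmx (graph_basis (cspan e) (1%:M - P)) = (lead e P - defect e P) *m J.
  by rewrite /defect opprD addNKr mulNmx JJ opprK.
by apply: submx_trans (submxMr J _) AJ; rewrite addmx_sub ?eqmx_opp.
Qed.

(** The defect lies in the normal plane if the latter is complex, and it projects
    to 0 on the base of the graph. *)
Lemma defect_complex : orth_projector P -> (P *m J <= P)%MS -> defect e P = 0.
Proof.
move=> hP PJ; have dP := defect_sub (stableJ_C hP PJ) (submx_refl _).
by rewrite (graph_basis_inj Pu rP dP) defect_dual mul0mx.
Qed.

End DefectProps.

(** The plane with antilinear part [w] and vanishing C-linear part. *)
Definition graph_plane e w : 'M[R]_N :=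
  1%:M - span_proj (col_mx (e + w) ((e - w) *m J)).

Lemma graph_plane_dual e w : e *m e^T = 1%:M -> w *m (cspan e)^T = 0 ->
  col_mx (e + w) ((e - w) *m J) *m (cspan e)^T = 1%:M.
Proof.
move=> ee we; rewrite -(cspan_unit ee) mul_col_mx mulmxDl we addr0 mulJ_cspan_tr.
by rewrite mulmxBl we subr0 -mulJ_cspan_tr -mul_col_mx.
Qed.

Lemma graph_planeP e w : e *m e^T = 1%:M -> w *m (cspan e)^T = 0 ->
  let P := graph_plane e w in
  [/\ orth_projector P, \rank P = K,
      cspan e *m (1%:M - P) *m (cspan e)^T \in unitmx & defect e P = w *+ 2].
Proof.
move=> ee we P; have YD := graph_plane_dual ee we.
set Y := col_mx _ _ in YD.
have Yu : Y *m (cspan e)^T \in unitmx by rewrite YD unitmx1.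
have Yf := dual_row_free Yu; have [hY YE] := span_projP Yf.
have PC : 1%:M - P = span_proj Y by rewrite /P /graph_plane opprB addrC subrK.
have hP : orth_projector P by exact: orth_projectorC.
split=> //.
- by rewrite /P /graph_plane rank_orth_projectorC // YE (eqP Yf); lia.
- by rewrite PC; exact: span_proj_dual.
rewrite /defect /lead PC graph_basis_span_proj // col_mxKu col_mxKd JJ.
by rewrite opprB addrC addrA subrK mulr2n.
Qed.

Lemma class_C_lead (V : normedModType R) k (U : set V) e (P : V -> 'M[R]_N) :
  open U ->
  (forall x, U x -> graph_locus (cspan e) (P x)) ->
  class_C k U P -> class_C k U (fun x => lead e (P x)).
Proof.
move=> oU Pu PC; apply: class_C_usubmx => //; apply: class_C_graph_basis => //.
by apply: class_CB => //; exact: class_C_cst.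
Qed.

Lemma class_C_defect (V : normedModType R) k (U : set V) e (P : V -> 'M[R]_N) :
  open U ->
  (forall x, U x -> graph_locus (cspan e) (P x)) ->
  class_C k U P -> class_C k U (fun x => defect e (P x)).
Proof.
move=> oU Pu PC; apply: class_CD => //; first exact: class_C_lead.
apply: class_CMmx => //; last exact: class_C_cst.
apply: class_C_dsubmx => //; apply: class_C_graph_basis => //.
by apply: class_CB => //; exact: class_C_cst.
Qed.

End Defect.

(** * Complex subspaces of a plane close to a complex one *)

(** The rows of [E] are a basis of a complex n-plane S0, and [e], [g] are unit
    vectors whose complex lines make up the orthogonal of S0. *)
Section BlowupChart.
Context {R : realType} {n : nat}.
Local Notation N := (n.+2 + n.+2)%N.
Local Notation J := (J R n).
Local Notation K := (2 * n + 2)%N.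
Variables (e g : 'rV[R]_N) (E : 'M[R]_(2 * n, N)).
Hypotheses (ee : e *m e^T = 1%:M) (gg : g *m g^T = 1%:M).
Hypotheses (ge : g *m (cspan e)^T = 0).
Hypothesis Ef : row_free E.
Hypotheses (Ee : E *m (cspan e)^T = 0) (Eg : E *m (cspan g)^T = 0).

Let D4 : 'M[R]_((1 + 1) + (1 + 1), N) := col_mx (cspan e) (cspan g).
Let G : 'M[R]_(2 * n + (1 + 1), N) := col_mx E (cspan g).

Let eg : cspan e *m (cspan g)^T = 0.
Proof. by rewrite -[cspan e]trmxK -trmx_mul cspan_dual0 ?trmx0. Qed.

Lemma normal_frame_dual : D4 *m D4^T = 1%:M.
Proof.
rewrite /D4 tr_col_mx mul_col_row !cspan_unit // eg (cspan_dual0 ge).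
by rewrite -scalar_mx_block.
Qed.

Lemma frame_free : row_free G.
Proof.
rewrite -kermx_eq0; apply/rowV0P => v /sub_kermxP.
rewrite -[v]hsubmxK /G mul_row_col => vG.
have r0 : rsubmx v = 0.
  have := congr1 (mulmx^~ (cspan g)^T) vG.
  by rewrite mulmxDl -!mulmxA Eg cspan_unit // mulmx0 add0r mulmx1 mul0mx.
move: vG; rewrite r0 mul0mx addr0 => /eqP.
by rewrite mulmx_free_eq0 // => /eqP ->; rewrite row_mx0.
Qed.

Lemma frame_sub (v : 'rV[R]_N) : v *m (cspan e)^T = 0 -> (v <= G)%MS.
Proof.
apply: orth_complement_sub; last by lia.
- by apply/row_freeP; exists (cspan e)^T; exact: cspan_unit.
- exact: frame_free.
- by rewrite /G mul_col_mx Ee (cspan_dual0 ge) col_mx0.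
Qed.

Let E_sub (v : 'rV[R]_N) : v *m D4^T = 0 -> (v <= E)%MS.
Proof.
apply: orth_complement_sub => //; last by lia.
  by apply/row_freeP; exists D4^T; exact: normal_frame_dual.
by rewrite /D4 tr_col_mx mul_mx_row Ee Eg row_mx0.
Qed.

(** The complex line of [slope u], for varying [u], runs through an affine chart
    of the projective space of the span of [g] and S0. *)
Definition slope (u : 'rV[R]_(2 * n)) : 'rV[R]_N := g + u *m E.

Lemma slope_dual_e u : slope u *m (cspan e)^T = 0.
Proof. by rewrite /slope mulmxDl -mulmxA ge Ee mulmx0 addr0. Qed.

Lemma slope_dual_g u : slope u *m (cspan g)^T = row_mx 1%:M 0.
Proof.
rewrite /slope mulmxDl -mulmxA Eg mulmx0 addr0.
have := congr1 usubmx (cspan_unit gg); rewrite -mul_usub_mx {1}/cspan col_mxKu => ->.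
by rewrite [X in usubmx X]scalar_mx_block /block_mx col_mxKu.
Qed.

(** The orthogonal of the complex n-plane that corresponds to [u]. *)
Definition blowup_span P (u : 'rV[R]_(2 * n)) : 'M[R]_((1 + 1) + (1 + 1), N) :=
  col_mx (cspan (lead e P)) (cspan (slope u)).

Definition scaled_slope (u : 'rV[R]_(2 * n)) (t : 'rV[R]_(1 + 1)) : 'rV[R]_N :=
  t *m cspan (slope u).

Lemma scaled_slope_dual_e u t : scaled_slope u t *m (cspan e)^T = 0.
Proof. by rewrite /scaled_slope -mulmxA cspan_dual0 ?mulmx0 ?slope_dual_e. Qed.

Lemma scaled_slope_dual_g u t : scaled_slope u t *m (cspan g)^T = t.
Proof. by rewrite /scaled_slope -mulmxA cspan_dual1 ?mulmx1 ?slope_dual_g. Qed.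

(** Selects in a basis lying over [D4] the vector that lies over [g]. *)
Definition third_row : 'rV[R]_((1 + 1) + (1 + 1)) := row_mx 0 (row_mx 1%:M 0).

Definition slope_of (S : 'M[R]_N) : 'rV[R]_N :=
  third_row *m graph_basis D4 (1%:M - S).

Definition slope_coord (S : 'M[R]_N) : 'rV[R]_(2 * n) := (slope_of S - g) *m pinvmx E.

Section AtPlane.
Variable P : 'M[R]_N.
Hypotheses (hP : orth_projector P) (rP : \rank P = K).
Hypothesis Pu : cspan e *m (1%:M - P) *m (cspan e)^T \in unitmx.

Let rPC : \rank (1%:M - P) = 2.
Proof. by rewrite rank_orth_projectorC // rP; lia. Qed.

Lemma blowup_span_dual u : blowup_span P u *m D4^T \in unitmx.
Proof.
rewrite /blowup_span /D4 tr_col_mx mul_col_row cspan_dual1 ?lead_dual //.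
rewrite (cspan_dual0 (slope_dual_e u)) (cspan_dual1 (slope_dual_g u)).
by rewrite unitmxE det_ublock !det1 mulr1 unitr1.
Qed.

Lemma blowup_span_stable u : (blowup_span P u *m J <= blowup_span P u)%MS.
Proof.
rewrite /blowup_span mul_col_mx -!addsmxE addsmxS ?cspan_stable //.
Qed.

(** The orthogonal of [S u] is a complex space that contains [lead e P] and the
    defect, hence the normal plane of [P]. *)
Lemma blowup_plane (S := fun u => 1%:M - span_proj (blowup_span P u)) u t :
  defect e P = scaled_slope u t ->
  [/\ [/\ orth_projector (S u), \rank (S u) = (2 * n)%N,
          complex_subspace (S u) & (S u <= P)%MS],
      D4 *m (1%:M - S u) *m D4^T \in unitmx & slope_coord (S u) = u].
Proof.
move=> dP; have Wu := blowup_span_dual u; have Wf := dual_row_free Wu.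
have [hW WE] := span_projP Wf.
have SC : 1%:M - S u = span_proj (blowup_span P u) by rewrite /S opprB addrC subrK.
have hS : orth_projector (S u) by exact: orth_projectorC.
have WJ := blowup_span_stable u.
have rS : \rank (S u) = (2 * n)%N.
  by rewrite /S rank_orth_projectorC // WE (eqP Wf); lia.
have sub_l : (lead e P <= blowup_span P u)%MS.
  exact: submx_trans (sub_col_mxu _ _) (sub_col_mxu _ _).
have sub_s : (cspan (slope u) <= blowup_span P u)%MS.
  exact: sub_col_mxd.
have Mu : D4 *m (1%:M - S u) *m D4^T \in unitmx by rewrite SC; exact: span_proj_dual.
split=> //; first split=> //.
- apply/complex_subspaceE; apply: stableJ_C => //.
  by rewrite (eqmxMr J WE) WE.
- rewrite -[P](subKr 1%:M) /S; apply: orth_projectorCS => //.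
    exact: orth_projectorC.
  rewrite WE; apply: (normal_sub Pu) => //.
  by rewrite dP /scaled_slope (submx_trans (submxMl _ _)).
have rM : \rank (1%:M - S u) = (1 + 1 + (1 + 1))%N by rewrite SC WE (eqP Wf).
have sM : (slope u <= 1%:M - S u)%MS.
  by rewrite SC WE (submx_trans _ sub_s) //; exact: sub_col_mxu.
have -> : slope_coord (S u) = (slope u - g) *m pinvmx E.
  rewrite /slope_coord /slope_of; congr ((_ - _) *m _).
  rewrite [RHS](graph_basis_inj Mu rM sM); congr (_ *m _).
  by rewrite /D4 tr_col_mx mul_mx_row slope_dual_e slope_dual_g.
by rewrite /slope addrC addKr -mulmxA mulmxVp // mulmx1.
Qed.

(** Conversely the orthogonal of [S] is a complex space containing the normal
    plane, hence [lead e P], and a graph over [D4], hence the vector [slope u]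
    over [g], where [u] is [slope_coord S]; these two span it. It
    contains the defect too, which is orthogonal to [e] and is thus a multiple of
    [slope u]. *)
Lemma blowup_plane_inv (S : 'M[R]_N) :
  orth_projector S -> \rank S = (2 * n)%N -> complex_subspace S -> (S <= P)%MS ->
  D4 *m (1%:M - S) *m D4^T \in unitmx ->
  defect e P = scaled_slope (slope_coord S) (defect e P *m (cspan g)^T) /\
  S = 1%:M - span_proj (blowup_span P (slope_coord S)).
Proof.
move=> hS rS /complex_subspaceE SJ SP Mu.
have rM : \rank (1%:M - S) = (1 + 1 + (1 + 1))%N.
  by rewrite rank_orth_projectorC // rS; lia.
have MJ := stableJ_C hS SJ; have PM := orth_projectorCS hS hP SP.
have sD : slope_of S *m D4^T = third_row.
  by rewrite /slope_of -mulmxA graph_basis_dual // mulmx1.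
have sE : slope_of S = slope (slope_coord S).
  rewrite /slope /slope_coord mulmxKpV ?subrKC //; apply: E_sub.
  rewrite mulmxBl sD -[g]addr0 -(mul0mx _ E) -/(slope 0).
  by rewrite /D4 tr_col_mx mul_mx_row slope_dual_e slope_dual_g subrr.
have sM : (slope (slope_coord S) <= 1%:M - S)%MS.
  by rewrite -sE /slope_of (submx_trans (submxMl _ _)) // graph_basis_sub.
have lM : (lead e P <= 1%:M - S)%MS by exact: submx_trans (lead_sub _ _) PM.
split; last first.
  have Wf := dual_row_free (blowup_span_dual (slope_coord S)).
  have [hW WE] := span_projP Wf.
  suff -> : span_proj (blowup_span P (slope_coord S)) = 1%:M - S by rewrite subKr.
  apply: eqmx_orth_projector => //; first exact: orth_projectorC.
  apply: eqmx_trans WE _; apply/eqmxP; rewrite -mxrank_leqif_eq.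
    by rewrite rM (eqP Wf).
  by rewrite /blowup_span -addsmxE addsmx_sub !cspan_sub.
set t := defect e P *m _.
have dM : (defect e P <= 1%:M - S)%MS by exact: defect_sub.
have tM : (scaled_slope (slope_coord S) t <= 1%:M - S)%MS.
  by rewrite /scaled_slope (submx_trans (submxMl _ _)) // cspan_sub.
rewrite (graph_basis_inj Mu rM dM) [RHS](graph_basis_inj Mu rM tM).
congr (_ *m _); rewrite /D4 tr_col_mx !mul_mx_row -/t.
by rewrite scaled_slope_dual_e scaled_slope_dual_g defect_dual.
Qed.

End AtPlane.
End BlowupChart.
(** * Local parametrizations and tangent spaces *)

Section Parametrizations.
Context {R : realType}.

Definition parametrizes (V : normedModType R) d (S U : set V) (B : set 'rV[R]_d)
    (phi : 'rV[R]_d -> V) (psi : V -> 'rV[R]_d) : Prop :=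
  [/\ open U & open B] /\
  [/\ smooth_on B phi, smooth_on U psi, phi @` B = S `&` U
    & forall b, B b -> psi (phi b) = b].

Lemma smooth_submanifoldP (V : normedModType R) d (S : set V) :
  smooth_submanifold d S <->
  forall p, S p -> exists (U : set V) (B : set 'rV[R]_d) phi psi,
    U p /\ parametrizes S U B phi psi.
Proof.
split=> SS p Sp; have := SS p Sp.
  by move=> [U [B [phi [psi [[oU Up oB] ?]]]]]; exists U, B, phi, psi.
by move=> [U [B [phi [psi [Up [[oU oB] ?]]]]]]; exists U, B, phi, psi.
Qed.

Section TangentSpace.
Context {d m : nat}.
Variables (X U : set 'rV[R]_m) (B : set 'rV[R]_d).
Variables (phi : 'rV[R]_d -> 'rV[R]_m) (psi : 'rV[R]_m -> 'rV[R]_d).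
Hypothesis charted : parametrizes X U B phi psi.

Lemma chart_image x : B x -> X (phi x) /\ U (phi x).
Proof.
case: charted => _ [_ _ XU _] Bx.
by have : (X `&` U) (phi x) by rewrite -XU; exists x.
Qed.

Lemma chart_inv q : X q -> U q -> B (psi q) /\ phi (psi q) = q.
Proof.
case: charted => _ [_ _ XU pp] Xq Uq.
have [x Bx <-] : (phi @` B) q by rewrite XU.
by rewrite pp.
Qed.

(** The Jacobian of the left inverse [psi] is a right inverse matrix, rows being
    acted upon from the right. *)
Lemma jacobian_chart_free x : B x -> row_free (jacobian phi x).
Proof.
case: charted => -[oU oB] [phiC psiC XU pp] Bx.
have [_ Ux] := chart_image Bx.
have dphi := (phiC 1%N).1 x Bx; have dpsi := (psiC 1%N).1 _ Ux.
have dcomp : differentiable (psi \o phi) x by exact: differentiable_comp.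
apply/row_freeP; exists (jacobian psi (phi x)).
apply/row_matrixP => i; rewrite !rowE mulmxA -(deriveEjacobian _ dphi).
rewrite -(deriveEjacobian _ dpsi) (deriveE _ dpsi) (deriveE _ dphi).
rewrite -[LHS]/(('d psi (phi x) \o 'd phi x) _) -diff_comp // -deriveE // mulmx1.
rewrite (@near_eq_derive _ _ _ (psi \o phi) id) ?derive_id //.
by apply: filterS (open_nbhs_nbhs (conj oB Bx)) => y /= /pp.
Qed.

Lemma curve_in_chart (c : R -> 'rV[R]_m) x : B x -> curve_at X (phi x) c ->
  \forall t \near (0 : R), B (psi (c t)) /\ c t = phi (psi (c t)).
Proof.
case: charted => -[oU oB] _ Bx [c0 [I [oI I0 cC IX]]].
have cc : {for 0, continuous c} by exact: class_C_continuous (cC 0%N) I0.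
have nI : nbhs (0 : R) I by exact: open_nbhs_nbhs.
have nU : \forall t \near (0 : R), U (c t).
  by apply: cc; rewrite c0; apply: open_nbhs_nbhs; have [_] := chart_image Bx.
apply: filterS2 nI nU => t /IX Xct Uct.
by have [? ->] := chart_inv Xct Uct.
Qed.

(** A curve in [X] is locally the image by [phi] of its image by [psi]; conversely
    [phi] maps straight lines to curves in [X]. *)
Lemma tangent_space_chart x : B x ->
  tangent_space X (phi x) = [set v | (v <= jacobian phi x)%MS].
Proof.
move=> Bx; have [[oU oB] [phiC psiC XU pp]] := charted.
have [_ Ux] := chart_image Bx.
have dphi := (phiC 1%N).1 x Bx; have dpsi := (psiC 1%N).1 _ Ux.
apply/seteqP; split=> [v [c cX cv]|v /submxP[w ->]] /=.
  have c0 : c 0 = phi x by case: cX.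
  have dpsic : is_derive (0 : R) 1 (psi \o c) ('D_v psi (phi x)).
    by rewrite -c0; apply: is_derive_curve => //; rewrite c0.
  have psic0 : (psi \o c) 0 = x by rewrite /= c0 pp.
  have dphic : is_derive (0 : R) 1 (phi \o (psi \o c)) ('D_('D_v psi (phi x)) phi x).
    by rewrite -[x in 'D_ _ _ x]psic0; apply: is_derive_curve => //; rewrite psic0.
  have dphic' : is_derive (0 : R) 1 c ('D_('D_v psi (phi x)) phi x).
    apply: near_eq_is_derive dphic.
    by apply: filterS (curve_in_chart Bx cX) => t [_ ->].
  have vE : v = 'D_('D_v psi (phi x)) phi x.
    by case: cv dphic' => _ cv [_ dc]; rewrite -{1}cv dc.
  by rewrite vE (deriveEjacobian _ dphi) submxMl.
pose l (t : R) := x + t *: w.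
have lC k : class_C k [set: R] l.
  apply: class_CD; [exact: openT|exact: class_C_cst|].
  by apply: class_CZl; [exact: openT|exact: class_C_id].
pose I := [set t | [set: R] t /\ B (l t)].
have oI : open I by exact: class_C_open openT oB (lC 0%N).
have l0 : l 0 = x by rewrite /l scale0r addr0.
exists (phi \o l).
  split; first by rewrite /= l0.
  exists I; split=> //; first by split=> //; rewrite l0.
    move=> k; apply: (@class_C_comp _ _ _ _ _ _ _ I B) => //; first by move=> t [].
    by apply: class_C_sub (lC k).
  by move=> t [_ /chart_image[]].
rewrite -deriveEjacobian // -[x in 'D_ _ _ x]l0.
apply: is_derive_curve; last by rewrite l0.
have -> : l = cst x + (fun t => t *: w) by [].
rewrite -[w in is_derive _ _ _ w]add0r; apply: is_deriveD.
apply: DeriveDef; first exact: diff_derivable.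
by rewrite deriveE // diff_val /= scale1r.
Qed.

(** Unlike [encode_subspace], which is defined by choice, this closed form shows that
    the tangent space depends smoothly on the point. *)
Definition tangent_plane (x : 'rV[R]_d) : 'M[R]_m := span_proj (jacobian phi x).

Lemma tangent_planeP x : B x -> [/\ orth_projector (tangent_plane x),
  \rank (tangent_plane x) = d & (tangent_plane x :=: jacobian phi x)%MS].
Proof.
move=> Bx; have Jf := jacobian_chart_free Bx; have [hP PE] := span_projP Jf.
by split=> //; rewrite PE (eqP Jf).
Qed.

Lemma class_C_tangent_plane k : class_C k B tangent_plane.
Proof.
have [[oU oB] [phiC _ _ _]] := charted.
apply: class_C_span_proj => //; last exact: class_C_jacobian.
exact: jacobian_chart_free.
Qed.

End TangentSpace.
End Parametrizations.
(** * The Gauss map and the fibres of the blow-up *)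

Section Gauss.
Context {R : realType} {n : nat}.
Local Notation N := (n.+2 + n.+2)%N.
Local Notation J := (J R n).
Local Notation K := (2 * n + 2)%N.
Local Notation total := ('rV[R]_N * ('M[R]_N * 'M[R]_N))%type.
Variable X : set 'rV[R]_N.

Lemma gauss_map_chart (U : set 'rV[R]_N) (B : set 'rV[R]_K) phi psi x :
  parametrizes X U B phi psi -> B x ->
  gauss_map X (phi x) = tangent_plane phi x.
Proof.
move=> XP Bx; rewrite /gauss_map (tangent_space_chart XP Bx).
have [hP PE] := encode_subspaceP (jacobian phi x).
have [hQ _ QE] := tangent_planeP XP Bx.
by apply: eqmx_orth_projector => //; exact: eqmx_trans PE (eqmx_sym QE).
Qed.

Hypothesis X_submanifold : smooth_submanifold K X.

Lemma gauss_mapP p : X p -> let P := gauss_map X p in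
  [/\ orth_projector P, \rank P = K & tangent_space X p = [set v | (v <= P)%MS]].
Proof.
move=> Xp.
have [U [B [phi [psi [Up XP]]]]] :=
  (smooth_submanifoldP _ _).1 X_submanifold _ Xp.
have [Bx px] := chart_inv XP Xp Up; have [hP rP PE] := tangent_planeP XP Bx.
rewrite -px /= (gauss_map_chart XP Bx); split=> //.
by rewrite (tangent_space_chart XP Bx); apply/seteqP; split=> v /=; rewrite PE.
Qed.

Lemma complex_tangentP p : X p -> let P := gauss_map X p in
  let H := encode_subspace (complex_tangent X p) in
  orth_projector H /\ (H :=: P :&: P *m J)%MS.
Proof.
move=> Xp P H; have [hP rP TP] := gauss_mapP Xp.
rewrite /H (_ : complex_tangent X p = [set v | (v <= P :&: P *m J)%MS]).
  exact: encode_subspaceP.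
rewrite /complex_tangent TP; apply/seteqP; split=> v /=; rewrite sub_capmx.
  by move=> [-> [w /= wP <-]]; rewrite submxMr.
move=> /andP[vP /submxP[D vE]]; split=> //; exists (D *m P); first exact: submxMl.
by rewrite vE mulmxA.
Qed.

Lemma complex_jump_complex p :
  complex_jump X p -> (gauss_map X p *m J <= gauss_map X p)%MS.
Proof.
move=> [Xp rH]; have [hH HE] := complex_tangentP Xp; have [hP rP _] := gauss_mapP Xp.
set P := gauss_map X p in HE rP *.
have PPJ : (P <= P *m J)%MS.
  apply: submx_trans (capmxSr P _).
  rewrite -(geq_leqif (mxrank_leqif_sup (capmxSl _ _))).
  by rewrite rP -HE rH.
by have := submxMr J PPJ; rewrite JJ eqmx_opp.
Qed.

(** If the tangent plane is not complex, its complex part is the only complex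
    n-plane that it contains: the real dimension of that part is less than 2n + 2,
    and it is even. *)
Lemma flag_cr_gauss p S : X p -> ~ complex_jump X p ->
  flag R n (S, gauss_map X p) -> (S, gauss_map X p) = cr_gauss_map X p.
Proof.
move=> Xp nj [[hS rS] /= SJ [hP rP] SP]; congr (_, _).
have [hH HE] := complex_tangentP Xp; set P := gauss_map X p in hP rP SP HE *.
set H := encode_subspace _ in hH HE *.
have SH : (S <= H)%MS.
  rewrite HE sub_capmx SP /=.
  by move: SJ => /andP[_ SJ]; exact: submx_trans SJ (submxMr J SP).
have HJ : (H *m J <= H)%MS.
  rewrite (eqmxMr J HE) HE sub_capmx; apply/andP; split.
    apply: submx_trans (submxMr J (capmxSr _ _)) _.
    by rewrite JJ eqmx_opp.
  exact: submxMr (capmxSl _ _).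
have rHle : (\rank H <= K)%N by rewrite -rP HE mxrankS // capmxSl.
have rHn : \rank H <> K by move=> rH; apply: nj.
have := stableJ_even HJ; have rSH := mxrankS SH.
move=> rHe; have rH : \rank H = (2 * n)%N.
  rewrite rS in rSH; lia.
apply: eqmx_orth_projector => //; apply/eqmxP; rewrite -mxrank_leqif_eq //.
by rewrite rS rH.
Qed.

Lemma graph_sub_blowup p S : X p -> ~ complex_jump X p ->
  flag R n (S, gauss_map X p) -> cr_nash_blowup X (p, (S, gauss_map X p)).
Proof.
move=> Xp nj SF; split; last by split.
apply: subset_closure; exists p => //.
by rewrite (flag_cr_gauss Xp nj SF).
Qed.

(** The tangent plane depends continuously on the point, so that over each point of
    [X] the closure of the graph contains no other real plane. *)
Lemma blowup_gauss q : cr_nash_blowup X q ->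
  [/\ X q.1, flag R n (q.2.1, gauss_map X q.1) & q.2.2 = gauss_map X q.1].
Proof.
case: q => p [S L] [/= clq [/= Xp SL]].
suff LE : L = gauss_map X p by rewrite -LE.
have [U [B [phi [psi [Up XP]]]]] :=
  (smooth_submanifoldP _ _).1 X_submanifold _ Xp.
have [Bx px] := chart_inv XP Xp Up; have [[oU oB] [_ psiC _ _]] := XP.
pose O := [set q | U q /\ B (psi q)].
have oO : open O by exact: class_C_open oU oB (psiC 0%N).
have psiO : class_C 0 O psi by apply: class_C_sub (psiC 0%N) => q [].
have TC : class_C 0 O (fun q => tangent_plane phi (psi q)).
  by apply: (class_C_comp _ _ _ psiO (class_C_tangent_plane XP 0)) => // q [].
have oO' : open (fst @^-1` O : set total).
  by apply: open_comp oO => q _; exact: cvg_fst.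
have TC' : class_C 0 (fst @^-1` O : set total) (fun q => tangent_plane phi (psi q.1)).
  exact: class_C_fst TC.
rewrite -px (gauss_map_chart XP Bx).
apply: (closure_eq (f := fun q : total => q.2.2)
  (g := fun q : total => tangent_plane phi (psi q.1)) clq).
- have nO : nbhs ((p, (S, L)) : total) (fst @^-1` O) by exact: open_nbhs_nbhs.
  apply: filterS nO => q [Uq Bq] [r [Xr _] re]; move: Uq Bq; rewrite -re /= => Ur Br.
  by rewrite -(gauss_map_chart XP Br) (chart_inv XP Xr Ur).2.
- by apply: continuous_comp; exact: cvg_snd.
- exact: (class_C_continuous TC').
Qed.

End Gauss.
(** * Charts at the points that are not complex jump points *)

Section RegularChart.
Context {R : realType} {n : nat}.
Local Notation N := (n.+2 + n.+2)%N.
Local Notation J := (J R n).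
Local Notation K := (2 * n + 2)%N.
Local Notation total := ('rV[R]_N * ('M[R]_N * 'M[R]_N))%type.

(** The complex space spanned by the normal plane of [P], provided that [D]
    projects to a basis of that plane. *)
Definition normal_cspan (D : 'M[R]_(2, N)) (P : 'M[R]_N) : 'M[R]_(2 + 2, N) :=
  col_mx (D *m (1%:M - P)) (D *m (1%:M - P) *m J).

(** The complex space spanned by the normal plane has even dimension, between 2 and
    4; were it 2, the normal plane would be complex. *)
Lemma normal_cspan_free (D : 'M[R]_(2, N)) P : orth_projector P -> \rank P = K ->
  (D :=: 1%:M - P)%MS -> ~ (P *m J <= P)%MS -> row_free (normal_cspan D P).
Proof.
move=> hP rP DE nPJ; have hC := orth_projectorC hP.
have DD : D *m (1%:M - P) = D by apply/eqP; rewrite -orth_projector_sub // DE.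
set W := normal_cspan D P.
have WJ : (W *m J <= W)%MS.
  rewrite /W /normal_cspan DD mul_col_mx JJ col_mx_sub eqmx_opp sub_col_mxd.
  exact: sub_col_mxu.
have PW : (1%:M - P <= W)%MS.
  by rewrite -DE /W /normal_cspan DD; exact: sub_col_mxu.
have := stableJ_even WJ; have := rank_leq_row W.
have := mxrankS PW; rewrite rank_orth_projectorC // rP => r2 r4 re.
rewrite /row_free; suff : \rank W <> 2 by move=> ?; apply/eqP; lia.
move=> rW; apply: nPJ.
have WE : (W :=: 1%:M - P)%MS.
  apply/eqmx_sym/eqmxP; rewrite -mxrank_leqif_eq // rW rank_orth_projectorC // rP.
  by apply/eqP; lia.
rewrite -[P](subKr 1%:M); apply: stableJ_C hC _.
by rewrite -(eqmxMr J WE) -WE.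
Qed.

Section Plane.
Variables (D : 'M[R]_(2, N)) (P : 'M[R]_N).
Hypotheses (hP : orth_projector P) (rP : \rank P = K).
Hypothesis Wf : row_free (normal_cspan D P).

Let rPC : \rank (1%:M - P) = 2.
Proof. by rewrite rank_orth_projectorC // rP; lia. Qed.

Let DP : (D *m (1%:M - P) :=: 1%:M - P)%MS.
Proof.
apply/eqmxP; rewrite -mxrank_leqif_eq ?submxMl // rPC.
have /row_freeP[C WC] := Wf; rewrite -[_ == _]/(row_free _).
apply/row_freeP; exists (C *m col_mx 1%:M 0).
rewrite mulmxA; have := congr1 usubmx WC.
rewrite -mul_usub_mx /normal_cspan col_mxKu => ->.
rewrite [X in usubmx X]scalar_mx_block /block_mx col_mxKu.
by rewrite mul_row_col mulmx1 mulmx0 addr0.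
Qed.

Lemma normal_cspan_min r (A : 'M[R]_(r, N)) :
  (A *m J <= A)%MS -> (1%:M - P <= A)%MS -> (normal_cspan D P <= A)%MS.
Proof.
move=> AJ PA; rewrite /normal_cspan col_mx_sub DP PA /=.
by rewrite (eqmxMr J DP) (submx_trans (submxMr J PA)).
Qed.

Lemma not_complex_plane : ~ (P *m J <= P)%MS.
Proof.
move=> PJ; have := mxrankS (normal_cspan_min (stableJ_C hP PJ) (submx_refl _)).
by rewrite rPC (eqP Wf).
Qed.

Lemma flag_normal_cspan : flag R n (1%:M - span_proj (normal_cspan D P), P).
Proof.
have [hW WE] := span_projP Wf; split=> /=; last 1 first.
- rewrite -[X in (_ <= X)%MS](subKr 1%:M); apply: orth_projectorCS => //.
    exact: orth_projectorC.
  by rewrite WE -DP; exact: sub_col_mxu.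
- split; first exact: orth_projectorC.
  by rewrite rank_orth_projectorC // WE (eqP Wf); lia.
- apply/complex_subspaceE; apply: stableJ_C => //; rewrite (eqmxMr J WE) WE.
  rewrite /normal_cspan mul_col_mx JJ col_mx_sub eqmx_opp sub_col_mxd.
  exact: sub_col_mxu.
- by [].
Qed.

(** The orthogonal of [S] is a complex space that contains the normal plane, and it
    has the least possible dimension. *)
Lemma flag_over_eq S : flag R n (S, P) -> S = 1%:M - span_proj (normal_cspan D P).
Proof.
move=> [[hS rS] /complex_subspaceE SJ _ SP]; have [hW WE] := span_projP Wf.
suff <- : 1%:M - S = span_proj (normal_cspan D P) by rewrite subKr.
apply: eqmx_orth_projector => //; first exact: orth_projectorC.
apply: eqmx_trans (eqmx_sym WE); apply/eqmx_sym/eqmxP; rewrite -mxrank_leqif_eq.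
  by rewrite rank_orth_projectorC // rS (eqP Wf); apply/eqP; lia.
apply: normal_cspan_min; first exact: stableJ_C.
exact: orth_projectorCS.
Qed.

End Plane.

Variable X : set 'rV[R]_N.
Hypothesis X_submanifold : smooth_submanifold K X.

(** Near such a point the blow-up is the graph of a smooth map over [X]. *)
Lemma blowup_chart_regular q : cr_nash_blowup X q -> ~ (q.2.2 *m J <= q.2.2)%MS ->
  exists (U : set total) (B : set 'rV[R]_K) phi psi,
    U q /\ parametrizes (cr_nash_blowup X) U B phi psi.
Proof.
case: q => p [S0 L] /= Xq; have [/= Xp SF LE] := blowup_gauss X_submanifold Xq.
have [U [B [phi [psi [Up XP]]]]] :=
  (smooth_submanifoldP _ _).1 X_submanifold _ Xp.
have [[oU oB] [phiC psiC _ pp]] := XP.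
pose Q := tangent_plane phi; have QC := class_C_tangent_plane XP.
have QE y : B y -> gauss_map X (phi y) = Q y by exact: gauss_map_chart XP.
have [Bx px] := chart_inv XP Xp Up; set x := psi p in Bx px.
rewrite LE => nLJ; have [hL rL _] := gauss_mapP X_submanifold Xp.
have [D Df DE] : exists2 D : 'M[R]_(2, N), row_free D & (D :=: 1%:M - gauss_map X p)%MS.
  by apply: exists_row_basis; rewrite rank_orth_projectorC // rL; lia.
have W0f := normal_cspan_free hL rL DE nLJ.
pose W y := normal_cspan D (Q y).
have WC k : class_C k B W.
  have DC : class_C k B (fun y => D *m (1%:M - Q y)).
    apply: class_CMmx => //; first exact: class_C_cst.
    by apply: class_CB => //; exact: class_C_cst.
  by apply: class_C_col_mx => //; apply: class_CMmx => //; exact: class_C_cst.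
have GC k : class_C k B (fun y => W y *m (W y)^T).
  by apply: class_CMmx => //; exact: class_C_tr.
pose B' := [set y | B y /\ W y *m (W y)^T \in unitmx].
have oB' : open B' by exact: class_C_open oB (@open_unitmx R (2 + 2)) (GC 0%N).
have Wf y : B' y -> row_free (W y).
  move=> [_ Gu]; apply/row_freeP; exists ((W y)^T *m invmx (W y *m (W y)^T)).
  by rewrite mulmxA mulmxV.
have B'x : B' x.
  by split=> //; apply: gram_unit; rewrite /W -(QE x Bx) px.
pose S y := 1%:M - span_proj (W y).
pose f y : total := (phi y, (S y, Q y)).
have fC k : class_C k B' f.
  have sB : B' `<=` B by move=> ? [].
  have sC (T : normedModType R) (h : 'rV[R]_K -> T) :
      class_C k B h -> class_C k B' h by exact: class_C_sub.
  apply: class_C_pair => //; first exact: sC.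
  apply: class_C_pair => //; last exact: sC.
  apply: class_CB => //; first exact: class_C_cst.
  by apply: class_C_span_proj => //; exact: sC.
pose U' := [set q : 'rV[R]_N | U q /\ B' (psi q)].
have oU' : open U' by exact: class_C_open oU oB' (psiC 0%N).
pose O := [set q : total | U' q.1].
have oO : open O.
  have oF : open (fst @^-1` U' : set total).
    by apply: open_comp oU' => z _; exact: cvg_fst.
  exact: oF.
exists O, B', f, (fun q => psi q.1); split; first by split.
split; split=> //.
- by move=> k; apply: class_C_fst (psiC k) => // z [].
- apply/seteqP; split=> [_ [y B'y <-]|[r [S1 L1]] [Xr [/= Ur B'r]]].
    have [By _] := B'y; have [Xy Uy] := chart_image XP By.
    have [hQy rQy _] := tangent_planeP XP By.
    have Of : U' (phi y) by split; [exact: Uy|rewrite (pp _ By); exact: B'y].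
    split; last exact: Of.
    rewrite /f -(QE y By); apply: graph_sub_blowup => //.
      move=> /(complex_jump_complex X_submanifold); rewrite QE //.
      exact: not_complex_plane hQy rQy (Wf y B'y).
    by rewrite QE //; exact: flag_normal_cspan hQy rQy (Wf y B'y).
  have [/= Xr1 SF1 ->] := blowup_gauss X_submanifold Xr.
  have [Br rE] := chart_inv XP Xr1 Ur; have [hQr rQr _] := tangent_planeP XP Br.
  exists (psi r) => //; rewrite /f rE -(QE _ Br) rE; congr (_, (_, _)).
  apply/esym; have QrE := QE _ Br; rewrite rE in QrE; rewrite QrE in SF1.
  exact: flag_over_eq hQr rQr (Wf _ B'r) _ SF1.
- by move=> y [By _] /=; rewrite pp.
Qed.

End RegularChart.
(** * Transversality makes the defect a coordinate system *)

Section DefectSubmersion.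
Context {R : realType} {n : nat}.
Local Notation N := (n.+2 + n.+2)%N.
Local Notation J := (J R n).
Local Notation K := (2 * n + 2)%N.

Section AtComplexPoint.
Variables (X : set 'rV[R]_N) (U : set 'rV[R]_N) (B : set 'rV[R]_K).
Variables (phi : 'rV[R]_K -> 'rV[R]_N) (psi : 'rV[R]_N -> 'rV[R]_K).
Hypothesis charted : parametrizes X U B phi psi.
Hypothesis X_transversal : gauss_transversal X.
Variables (x0 : 'rV[R]_K) (e : 'rV[R]_N) (G : 'M[R]_(K, N)).
Hypothesis Bx0 : B x0.
Let P0 := gauss_map X (phi x0).
Hypotheses (hP0 : orth_projector P0) (rP0 : \rank P0 = K) (P0J : (P0 *m J <= P0)%MS).
Hypotheses (ee : e *m e^T = 1%:M) (eP0 : (e <= 1%:M - P0)%MS).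
Hypotheses (Gf : row_free G) (Ge : G *m (cspan e)^T = 0).

Lemma complex_normal_graph : graph_locus (cspan e) P0.
Proof.
have : (cspan e <= 1%:M - P0)%MS by apply: cspan_sub => //; exact: stableJ_C.
rewrite /graph_locus /= orth_projector_sub; last exact: orth_projectorC.
by move=> /eqP ->; rewrite cspan_unit ?unitmx1.
Qed.

(** The coordinates of the defect in the basis [G] of the plane [P0]. *)
Let Phi (P : 'M[R]_N) : 'rV[R]_K := defect e P *m pinvmx G.

Let PhiC k : class_C k (graph_locus (cspan e)) Phi.
Proof.
have oO : open (graph_locus (cspan e)) by exact: open_graph_locus.
apply: class_CMmx => //; last exact: class_C_cst.
by apply: class_C_defect => //; exact: class_C_id.
Qed.

Let dPhi : differentiable Phi P0.
Proof. exact: (PhiC 1).1 complex_normal_graph. Qed.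

(** The graphs with antilinear part [s *: w] form a curve of planes along which the
    defect is [2 s w]. *)
Lemma normal_direction (v : 'rV[R]_K) : exists2 a,
  tangent_space (Gr R K N) P0 a & 'D_a Phi P0 = v.
Proof.
pose w : 'rV[R]_N := 2^-1 *: (v *m G).
have we (s : R) : (s *: w) *m (cspan e)^T = 0.
  by rewrite /w -!scalemxAl -mulmxA Ge mulmx0 !scaler0.
pose gam (s : R) := graph_plane e (s *: w).
have gamP s := graph_planeP ee (we s).
have gam0 : gam 0 = P0.
  rewrite /gam scale0r /graph_plane addr0 subr0 -/(cspan e).
  have cf : row_free (cspan e).
    by apply/row_freeP; exists (cspan e)^T; exact: cspan_unit.
  have [hc cE] := span_projP cf.
  suff -> : span_proj (cspan e) = 1%:M - P0 by rewrite subKr.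
  apply: eqmx_orth_projector => //; first exact: orth_projectorC.
  apply: eqmx_trans cE _; apply/eqmxP; rewrite -mxrank_leqif_eq.
    by rewrite rank_orth_projectorC // rP0 (eqP cf); apply/eqP; lia.
  by apply: cspan_sub => //; exact: stableJ_C.
have gamC k : class_C k [set: R] gam.
  have lC : class_C k [set: R] (fun s => s *: w).
    by apply: class_CZl; [exact: openT|exact: class_C_id].
  apply: class_CB; [exact: openT|exact: class_C_cst|].
  apply: class_C_span_proj; first exact: openT.
    move=> s _; apply: (@dual_row_free _ _ _ (cspan e)).
    by rewrite graph_plane_dual ?unitmx1.
  apply: class_C_col_mx; first exact: openT.
    by apply: class_CD; [exact: openT|exact: class_C_cst|].
  apply: class_CMmx; [exact: openT| |exact: class_C_cst].
  by apply: class_CB; [exact: openT|exact: class_C_cst|].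
have dgam : derivable gam (0 : R) 1 by apply/derivable1_diffP; exact: (gamC 1%N).1.
exists ('D_1 gam 0).
  exists gam; last exact: derivableP.
  split=> //; exists [set: R]; split=> //; first exact: openT.
  by move=> s _; have [hg rg _ _] := gamP s.
have d1 : is_derive (0 : R) 1 (Phi \o gam) ('D_('D_1 gam 0) Phi P0).
  rewrite -[in 'D__ Phi _]gam0; apply: is_derive_curve; first exact: derivableP.
  by rewrite gam0.
have E : Phi \o gam = fun s => s *: v.
  apply/funext => s; have [_ _ _ dg] := gamP s.
  rewrite /Phi /= /gam dg -scaler_nat /w -!scalemxAl !scalerA -mulmxA mulmxVp // mulmx1.
  by congr (_ *: _); field.
have d2 : is_derive (0 : R) 1 (Phi \o gam) v.
  rewrite E; apply: DeriveDef; first exact: diff_derivable.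
  by rewrite deriveE // diff_val /= scale1r.
exact: is_derive_unique d1 d2.
Qed.

Lemma complex_direction b : tangent_space (complex_locus R n) P0 b -> 'D_b Phi P0 = 0.
Proof.
move=> [c [c0 [I [oI I0 cC cI]]] cb].
have d1 : is_derive (0 : R) 1 (Phi \o c) ('D_b Phi P0).
  by rewrite -c0; apply: is_derive_curve => //; rewrite c0.
have cc : {for 0, continuous c} by exact: class_C_continuous (cC 0%N) I0.
have nO : \forall s \near (0 : R), graph_locus (cspan e) (c s).
  apply: cc; rewrite c0; apply: open_nbhs_nbhs; split.
    exact: open_graph_locus.
  exact: complex_normal_graph.
have nI : nbhs (0 : R) I by exact: open_nbhs_nbhs.
have d2 : is_derive (0 : R) 1 (Phi \o c) 0.
  apply: near_eq_is_derive (is_derive_cst 0 (0 : R) 1).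
  apply: filterS2 nO nI => s Os /cI[[hs rs] /complex_subspaceE sJ].
  rewrite /Phi /= defect_complex ?mul0mx // rank_orth_projectorC // rs; lia.
exact: is_derive_unique d1 d2.
Qed.

Lemma gauss_direction a : differential_image (gauss_map X) X (phi x0) a ->
  exists w, 'D_a Phi P0 = w *m jacobian (fun x => Phi (tangent_plane phi x)) x0.
Proof.
move=> [c cX ca]; have [c0 [I [oI I0 cC cI]]] := cX.
have [[oU oB] [phiC psiC XU pp]] := charted.
have [_ Ux0] := chart_image charted Bx0.
pose Q := tangent_plane phi; have QC := class_C_tangent_plane charted.
have Q0 : Q x0 = P0 by rewrite /P0 (gauss_map_chart charted Bx0).
have d1 : is_derive (0 : R) 1 (Phi \o (gauss_map X \o c)) ('D_a Phi P0).
  rewrite /P0 -c0 -[gauss_map X (c 0)]/((gauss_map X \o c) 0).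
  by apply: is_derive_curve => //=; rewrite c0.
have psic0 : (psi \o c) 0 = x0 by rewrite /= c0 pp.
have dc : differentiable c 0 by exact: (cC 1%N).1.
have dpsic : differentiable (psi \o c) 0.
  by apply: differentiable_comp => //; rewrite c0; exact: (psiC 1%N).1.
have dPQ : differentiable (fun x => Phi (Q x)) x0.
  apply: (@differentiable_comp _ _ _ _ Q Phi); first exact: (QC 1%N).1.
  by rewrite Q0.
have d2 : is_derive (0 : R) 1 ((fun x => Phi (Q x)) \o (psi \o c))
    ('D_('D_1 (psi \o c) 0) (fun x => Phi (Q x)) ((psi \o c) 0)).
  apply: is_derive_curve; last by rewrite psic0.
  exact/derivableP/diff_derivable.
rewrite psic0 in d2.
have d3 := near_eq_is_derive (g := Phi \o (gauss_map X \o c)) _ d2.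
exists ('D_1 (psi \o c) 0); rewrite -(deriveEjacobian _ dPQ).
apply: (is_derive_unique d1 (d3 _)).
apply: filterS (curve_in_chart charted Bx0 cX) => s [Bs cs].
by rewrite /= [in RHS]cs (gauss_map_chart charted Bs).
Qed.

(** Transversality splits a tangent vector of the Grassmannian on which the
    differential of [Phi] takes a prescribed value into a vector tangent to the
    complex planes, on which that differential vanishes, and an image of a tangent
    vector of [X]. *)
Lemma defect_jacobian_unit :
  jacobian (fun x => defect e (tangent_plane phi x) *m pinvmx G) x0 \in unitmx.
Proof.
set Jac := jacobian _ _; rewrite -row_full_unit; apply/row_fullP.
suff sur (v : 'rV[R]_K) : exists w : 'rV[R]_K, w *m Jac = v.
  exists (\matrix_(i < K) sval (cid (sur (row i 1%:M)))).
  apply/row_matrixP => i; rewrite row_mul rowK.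
  by case: cid.
have [a aG av] := normal_direction v.
have P0C : complex_locus R n P0 by split; [split|exact/complex_subspaceE].
move: aG; rewrite -(X_transversal (chart_image charted Bx0).1 P0C).
move=> [a1 /gauss_direction[w wE] [b /complex_direction bE ab]].
exists w; rewrite -av -ab deriveE // linearD -!deriveE //.
by rewrite wE bE addr0.
Qed.

End AtComplexPoint.
End DefectSubmersion.
(** * Blow-up charts at the complex jump points *)

Section JumpChart.
Context {R : realType} {n : nat}.
Local Notation N := (n.+2 + n.+2)%N.
Local Notation J := (J R n).
Local Notation K := (2 * n + 2)%N.
Local Notation K' := (2 * n + (1 + 1))%N.
Local Notation total := ('rV[R]_N * ('M[R]_N * 'M[R]_N))%type.

Lemma near_rsubmx_neq0 a b (w : 'rV[R]_(a + b.+1)) (A : set 'rV[R]_(a + b.+1)) :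
  nbhs w A -> exists2 w', A w' & rsubmx w' != 0.
Proof.
move=> /nbhs_ballP[r /= r0 rA].
have [w0|w0] := eqVneq (rsubmx w) 0; last first.
  by exists w => //; apply: rA; exact: ballxx.
exists (row_mx (lsubmx w) (const_mx (r / 2))); last first.
  rewrite row_mxKr; apply/eqP => /matrixP/(_ 0 0); rewrite !mxE; lra.
apply: rA; rewrite -ball_normE /ball_ /= -{1}[w]hsubmxK w0 opp_row_mx add_row_mx.
rewrite subrr add0r; apply: (@le_lt_trans _ _ (r / 2)); last by lra.
apply: norm_le_coord => [|i j]; first by lra.
case: (split_ordP j) => l ->; rewrite ?row_mxEl ?row_mxEr !mxE;
  rewrite ?normr0 ?normrN ?ger0_norm; lra.
Qed.

(** The complement of S in P is a complex line, generated by [g]. *)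
Lemma adapted_frame (S P : 'M[R]_N) : flag R n (S, P) -> (P *m J <= P)%MS ->
  exists (e g : 'rV[R]_N) (E : 'M[R]_(2 * n, N)),
    [/\ e *m e^T = 1%:M, g *m g^T = 1%:M, g *m (cspan e)^T = 0 & row_free E] /\
    [/\ E *m (cspan e)^T = 0, E *m (cspan g)^T = 0, (e <= 1%:M - P)%MS
      & (col_mx (cspan e) (cspan g) <= 1%:M - S)%MS].
Proof.
move=> [[hS rS] /complex_subspaceE SJ [hP rP] SP] PJ; rewrite /= in hS rS SJ hP rP SP.
have rPC : \rank (1%:M - P) = 2 by rewrite rank_orth_projectorC // rP; lia.
have [|e eP ee] := @exists_unit_row R _ _ (1%:M - P); first by rewrite rPC.
have [|g gPS gg] := @exists_unit_row R _ _ (P :&: (1%:M - S))%MS.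
  have := mxrank_sum_cap P (1%:M - S); rewrite rank_orth_projectorC // rS rP.
  by have := rank_leq_row (P + (1%:M - S))%MS; lia.
have [E Ef ES] := exists_row_basis rS.
have ceP : (cspan e <= 1%:M - P)%MS by apply: cspan_sub => //; exact: stableJ_C.
move: gPS; rewrite sub_capmx => /andP[gP gS].
have cgS : (cspan g <= 1%:M - S)%MS by apply: cspan_sub => //; exact: stableJ_C.
exists e, g, E; split; split=> //.
- exact: orth_sub_mul0 hP gP ceP.
- by apply: orth_sub_mul0 hP _ ceP; rewrite ES.
- by apply: orth_sub_mul0 hS _ cgS; rewrite ES.
- rewrite col_mx_sub cgS andbT.
  exact: submx_trans ceP (orth_projectorCS hS hP SP).
Qed.

Variable X : set 'rV[R]_N.
Hypothesis X_submanifold : smooth_submanifold K X.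

Section Chart.
Variables (U : set 'rV[R]_N) (B : set 'rV[R]_K).
Variables (phi : 'rV[R]_K -> 'rV[R]_N) (psi : 'rV[R]_N -> 'rV[R]_K).
Hypothesis charted : parametrizes X U B phi psi.
Variables (e g : 'rV[R]_N) (E : 'M[R]_(2 * n, N)).
Hypotheses (ee : e *m e^T = 1%:M) (gg : g *m g^T = 1%:M).
Hypotheses (ge : g *m (cspan e)^T = 0) (Ef : row_free E).
Hypotheses (Ee : E *m (cspan e)^T = 0) (Eg : E *m (cspan g)^T = 0).

Let Q := tangent_plane phi.
Let G : 'M[R]_(K', N) := col_mx E (cspan g).
Let D4 : 'M[R]_((1 + 1) + (1 + 1), N) := col_mx (cspan e) (cspan g).

Definition graph_domain : set 'rV[R]_K := [set x | B x /\ graph_locus (cspan e) (Q x)].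

(** The components of the defect in the basis [G] of the orthogonal of [e]. *)
Definition defect_coord (x : 'rV[R]_K) : 'rV[R]_K := defect e (Q x) *m pinvmx G.

Let oB : open B. Proof. by case: charted => -[]. Qed.
Let phiC : smooth_on B phi. Proof. by case: charted => _ []. Qed.
Let psiC : smooth_on U psi. Proof. by case: charted => _ []. Qed.
Let phiK x : B x -> psi (phi x) = x.
Proof. by case: charted => _ [_ _ _ pp]; exact: pp. Qed.

Lemma open_graph_domain : open graph_domain.
Proof.
exact: class_C_open oB (@open_graph_locus _ _ _ _) (class_C_tangent_plane charted 0).
Qed.

Let QC k : class_C k graph_domain Q.
Proof. by apply: class_C_sub (class_C_tangent_plane charted k) => x []. Qed.

Lemma smooth_defect_coord : smooth_on graph_domain defect_coord.
Proof.
move=> k; have oD := open_graph_domain.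
apply: class_CMmx => //; last exact: class_C_cst.
by apply: class_C_defect => // x [].
Qed.

(** The defect is a local diffeomorphism onto [V1], with inverse [h]. *)
Variables (B1 V1 : set 'rV[R]_K) (h : 'rV[R]_K -> 'rV[R]_K).
Hypotheses (oB1 : open B1) (B1D : B1 `<=` graph_domain) (oV1 : open V1).
Hypothesis hC : smooth_on V1 h.
Hypotheses (dV : forall x, B1 x -> V1 (defect_coord x)).
Hypotheses (hd : forall x, B1 x -> h (defect_coord x) = x).
Hypotheses (hB : forall y, V1 y -> B1 (h y)).
Hypotheses (dh : forall y, V1 y -> defect_coord (h y) = y).

(** The blow-down (u, t) |-> t (g + u E), in the basis [G]. *)
Definition blow_down (w : 'rV[R]_K') : 'rV[R]_K :=
  scaled_slope g E (lsubmx w) (rsubmx w) *m pinvmx G.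

Definition jump_domain : set 'rV[R]_K' := [set w | setT w /\ V1 (blow_down w)].

Let base (w : 'rV[R]_K') : 'rV[R]_K := h (blow_down w).
Let span4 w := blowup_span e g E (Q (base w)) (lsubmx w).

Definition jump_chart (w : 'rV[R]_K') : total :=
  (phi (base w), (1%:M - span_proj (span4 w), Q (base w))).

Definition jump_locus : set total :=
  [set q | (U q.1 /\ B1 (psi q.1)) /\ graph_locus D4 q.2.1].

Definition jump_chart_inv (q : total) : 'rV[R]_K' :=
  row_mx (slope_coord e g E q.2.1) (defect e (Q (psi q.1)) *m (cspan g)^T).

Let class_C_cspan (V : normedModType R) k (O : set V) (v : V -> 'rV[R]_N) :
  open O -> class_C k O v -> class_C k O (fun w => cspan (v w)).
Proof.
move=> oO vC; apply: class_C_col_mx => //.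
by apply: class_CMmx => //; exact: class_C_cst.
Qed.

Let class_C_slope k (O : set 'rV[R]_K') : open O ->
  class_C k O (fun w => slope g E (lsubmx w)).
Proof.
move=> oO; apply: class_CD => //; first exact: class_C_cst.
apply: class_CMmx => //; last exact: class_C_cst.
by apply: class_C_lsubmx => //; exact: class_C_id.
Qed.

Let class_C_blow_down k (O : set 'rV[R]_K') : open O -> class_C k O blow_down.
Proof.
move=> oO; apply: class_CMmx => //; last exact: class_C_cst.
apply: class_CMmx => //; last by apply: class_C_cspan => //; exact: class_C_slope.
by apply: class_C_rsubmx => //; exact: class_C_id.
Qed.

Lemma open_jump_domain : open jump_domain.
Proof. exact: class_C_open openT oV1 (class_C_blow_down 0 openT). Qed.

Let base_B1 w : jump_domain w -> B1 (base w).
Proof. by move=> [_ /hB]. Qed.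

Let base_domain w : jump_domain w -> graph_domain (base w).
Proof. by move=> /base_B1/B1D. Qed.

Let class_C_base k : class_C k jump_domain base.
Proof.
have oW := open_jump_domain.
by apply: (class_C_comp oW oV1 _ (class_C_blow_down k oW) (hC k)) => w [].
Qed.

Lemma defect_base w : jump_domain w ->
  defect e (Q (base w)) = scaled_slope g E (lsubmx w) (rsubmx w).
Proof.
move=> Ww; have Gsub := frame_sub ee gg ge Ef Ee Eg.
have [_ Qu] := base_domain Ww.
transitivity (defect_coord (base w) *m G).
  by rewrite /defect_coord mulmxKpV // Gsub // defect_dual.
by rewrite /base (dh Ww.2) /blow_down mulmxKpV // Gsub // scaled_slope_dual_e.
Qed.

Lemma smooth_jump_chart : smooth_on jump_domain jump_chart.
Proof.
move=> k; have oW := open_jump_domain; have oD := open_graph_domain.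
have QbC : class_C k jump_domain (fun w => Q (base w)).
  exact: (class_C_comp oW oD base_domain (class_C_base k) (QC k)).
apply: class_C_pair => //.
  apply: (class_C_comp oW oB _ (class_C_base k) (phiC k)) => w Ww.
  exact: (base_domain Ww).1.
apply: class_C_pair => //; apply: class_CB => //; first exact: class_C_cst.
apply: class_C_span_proj => // [w Ww|].
  apply: dual_row_free; apply: (blowup_span_dual gg ge Ee Eg) => //.
  exact: (base_domain Ww).2.
apply: class_C_col_mx => //; apply: class_C_cspan => //; last exact: class_C_slope.
by apply: class_C_lead => // w Ww; exact: (base_domain Ww).2.
Qed.

Lemma jump_chart_plane w : jump_domain w -> let S := 1%:M - span_proj (span4 w) in
  [/\ flag R n (S, Q (base w)), graph_locus D4 S & slope_coord e g E S = lsubmx w].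
Proof.
move=> Ww; have [Bw Qu] := base_domain Ww.
have [hQ rQ _] := tangent_planeP charted Bw.
have [[h1 h2 h3 h4] h5 h6] := blowup_plane gg ge Ef Ee Eg hQ rQ Qu (defect_base Ww).
by split.
Qed.

(** Off the exceptional divisor [t = 0] the defect, and with it the tangent plane,
    is not complex. *)
Lemma jump_chart_graph w : jump_domain w -> rsubmx w != 0 ->
  [set (p, cr_gauss_map X p) | p in X `\` complex_jump X] (jump_chart w).
Proof.
move=> Ww tw; have [Bw Qu] := base_domain Ww.
have [hQ rQ _] := tangent_planeP charted Bw.
have [Xw _] := chart_image charted Bw; have [Fw _ _] := jump_chart_plane Ww.
have QE := gauss_map_chart charted Bw; rewrite /Q -QE in Fw.
have nj : ~ complex_jump X (phi (base w)).
  move=> /(complex_jump_complex X_submanifold); rewrite QE => QJ.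
  have rQC : \rank (1%:M - Q (base w)) = 2.
    by rewrite rank_orth_projectorC // rQ; lia.
  have := defect_base Ww; rewrite defect_complex //.
  move=> /(congr1 (mulmx^~ (cspan g)^T)); rewrite mul0mx scaled_slope_dual_g //.
  by move=> t0; rewrite -t0 eqxx in tw.
exists (phi (base w)); first by split.
by rewrite -(flag_cr_gauss X_submanifold Xw nj Fw) QE.
Qed.

Lemma jump_chart_blowup w : jump_domain w -> cr_nash_blowup X (jump_chart w).
Proof.
move=> Ww; have [Bw _] := base_domain Ww; have [Xw _] := chart_image charted Bw.
have [Fw _ _] := jump_chart_plane Ww; split; last by split.
(* The points off the exceptional divisor are dense in the chart. *)
move=> A nA; have nW : nbhs w (jump_chart @^-1` A `&` jump_domain).
  apply: filterI; first exact: (class_C_continuous (smooth_jump_chart 0) Ww).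
  by apply: open_nbhs_nbhs; split; [exact: open_jump_domain|].
have [w' [Aw' Ww'] tw'] := near_rsubmx_neq0 nW.
by exists (jump_chart w'); split=> //; exact: jump_chart_graph.
Qed.

Lemma jump_chart_locus w : jump_domain w -> jump_locus (jump_chart w).
Proof.
move=> Ww; have [_ Mw _] := jump_chart_plane Ww; have [Bw _] := base_domain Ww.
have [_ Uw] := chart_image charted Bw; split; last exact: Mw.
by split; [exact: Uw|rewrite /= (phiK Bw); exact: base_B1].
Qed.

Lemma jump_chartK w : jump_domain w -> jump_chart_inv (jump_chart w) = w.
Proof.
move=> Ww; have [_ _ sw] := jump_chart_plane Ww; have [Bw _] := base_domain Ww.
rewrite /jump_chart_inv /jump_chart /= sw (phiK Bw) (defect_base Ww).
by rewrite scaled_slope_dual_g // hsubmxK.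
Qed.

Lemma jump_chart_invK q : cr_nash_blowup X q -> jump_locus q ->
  jump_domain (jump_chart_inv q) /\ jump_chart (jump_chart_inv q) = q.
Proof.
case: q => r [S L] Xr [[/= Ur B1r] Mr].
have [/= Xr1 SF ->] := blowup_gauss X_submanifold Xr.
have [Br rE] := chart_inv charted Xr1 Ur; have [_ Qu] := B1D B1r.
have [hQ rQ _] := tangent_planeP charted Br.
have QE := gauss_map_chart charted Br; rewrite rE in QE; rewrite QE in SF *.
case: SF => /= -[hS rS] SJ _ SQ.
have [dS SE] := blowup_plane_inv ee gg ge Ef Ee Eg hQ rQ Qu hS rS SJ SQ Mr.
set q := (r, _); have bq : blow_down (jump_chart_inv q) = defect_coord (psi r).
  by rewrite /blow_down /jump_chart_inv /= row_mxKl row_mxKr -dS.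
have baseE : base (jump_chart_inv q) = psi r by rewrite /base bq (hd B1r).
split; first by split; [exact: I|rewrite bq; exact: dV].
rewrite /jump_chart /span4 baseE rE; congr (_, (_, _)).
by rewrite [RHS]SE /jump_chart_inv /= row_mxKl.
Qed.

Let oU1 : open [set p | U p /\ B1 (psi p)].
Proof. by case: charted => -[oU _] _; exact: class_C_open oU oB1 (psiC 0). Qed.

Lemma open_jump_locus : open jump_locus.
Proof.
have o1 : open (fst @^-1` [set p | U p /\ B1 (psi p)] : set total).
  by apply: open_comp oU1 => z _; exact: cvg_fst.
have o2 : open ((fun q : total => q.2.1) @^-1` graph_locus D4).
  apply: open_comp (@open_graph_locus _ _ _ _) => z _.
  by apply: continuous_comp; [exact: cvg_snd|exact: cvg_fst].
exact: openI o1 o2.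
Qed.

Lemma smooth_jump_chart_inv : smooth_on jump_locus jump_chart_inv.
Proof.
move=> k; have oO := open_jump_locus; have oD := open_graph_domain.
have oM : open (graph_locus D4) by exact: open_graph_locus.
apply: class_C_row_mx => //.
  have sC : class_C k (graph_locus D4) (slope_coord e g E).
    apply: class_CMmx => //; last exact: class_C_cst.
    apply: class_CB => //; last exact: class_C_cst.
    apply: class_CMmx => //; first exact: class_C_cst.
    apply: class_C_graph_basis => //.
    by apply: class_CB => //; [exact: class_C_cst|exact: class_C_id].
  have oF : open (fst @^-1` graph_locus D4 : set ('M[R]_N * 'M[R]_N)%type).
    by apply: open_comp oM => z _; exact: cvg_fst.
  have sC2 := class_C_fst oF (fun=> id) sC.
  by apply: (class_C_snd oO _ sC2) => z [].
apply: class_CMmx => //; last exact: class_C_cst.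
have U1D p : (U p /\ B1 (psi p)) -> graph_domain (psi p) by move=> [_ /B1D].
have psiC1 : class_C k [set p | U p /\ B1 (psi p)] psi.
  by apply: class_C_sub (psiC k) => z [].
have QpC := class_C_comp oU1 oD U1D psiC1 (QC k).
have dC : class_C k [set p | U p /\ B1 (psi p)] (fun p => defect e (Q (psi p))).
  by apply: class_C_defect => // p /U1D[].
by apply: (class_C_fst oO _ dC) => q [].
Qed.

Lemma jump_chart_parametrizes :
  parametrizes (cr_nash_blowup X) jump_locus jump_domain jump_chart jump_chart_inv.
Proof.
split; first by split; [exact: open_jump_locus|exact: open_jump_domain].
split; [exact: smooth_jump_chart|exact: smooth_jump_chart_inv| |exact: jump_chartK].
apply/seteqP; split=> [_ [w Ww <-]|q [Xq Oq]].
  by split; [exact: jump_chart_blowup|exact: jump_chart_locus].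
by have [Ww wE] := jump_chart_invK Xq Oq; exists (jump_chart_inv q).
Qed.

End Chart.

Hypothesis X_transversal : gauss_transversal X.

Lemma blowup_chart_jump q : cr_nash_blowup X q -> (q.2.2 *m J <= q.2.2)%MS ->
  exists (U : set total) (B : set 'rV[R]_K) phi psi,
    U q /\ parametrizes (cr_nash_blowup X) U B phi psi.
Proof.
case: q => p [S L] /= Xq; have [/= Xp SF LE] := blowup_gauss X_submanifold Xq.
rewrite LE => PJ.
have [U [B [phi [psi [Up XP]]]]] :=
  (smooth_submanifoldP _ _).1 X_submanifold _ Xp.
have [e [g [E [[ee gg ge Ef] [Ee Eg eP DS]]]]] := adapted_frame SF PJ.
have [hP rP _] := gauss_mapP X_submanifold Xp.
have [Bx px] := chart_inv XP Xp Up; rewrite -px in PJ hP rP eP.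
have Gf := frame_free gg Ef Eg.
have Ge : col_mx E (cspan g) *m (cspan e)^T = 0.
  by rewrite mul_col_mx Ee (cspan_dual0 ge) col_mx0.
have Dx : graph_domain B phi e (psi p).
  split=> //; have := complex_normal_graph hP PJ ee eP.
  by rewrite (gauss_map_chart XP Bx).
have Ju := defect_jacobian_unit XP X_transversal Bx hP rP PJ ee eP Gf Ge.
have oD := open_graph_domain XP; have dC := smooth_defect_coord XP.
have [B1 [V1 [h [[oB1 B1x B1D oV1] [hC dV hd hB dh]]]]] :=
  inverse_function (oD e) Dx (dC e g E) Ju.
have JP := jump_chart_parametrizes XP
  ee gg ge Ef Ee Eg oB1 B1D oV1 hC dV hd hB dh.
exists (jump_locus U psi e g B1), (jump_domain g E V1),
  (jump_chart phi e g E h), (jump_chart_inv phi psi e g E).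
split; last exact: JP.
split; first by split.
have [[hS _] _ _ _] := SF; move: DS.
rewrite orth_projector_sub; last exact: orth_projectorC.
by rewrite /graph_locus /= => /eqP ->; rewrite normal_frame_dual ?unitmx1.
Qed.

End JumpChart.

Unset Implicit Arguments.

Theorem theorem9 (R : realType) (n : nat) (n_gt0 : (0 < n)%N)
    (X : set 'rV[R]_(n.+2 + n.+2))
    (X_submanifold : smooth_submanifold (2 * n + 2) X)
    (X_transversal : gauss_transversal X) :
  smooth_submanifold_of (X `*` flag R n) (cr_nash_blowup X).
Proof.
split; first by move=> q [].
exists (2 * n + 2)%N; apply/smooth_submanifoldP => q Xq.
have [LJ|nLJ] := boolP (q.2.2 *m J R n <= q.2.2)%MS.
  exact: blowup_chart_jump.
by apply: blowup_chart_regular => //; exact/negP.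
Qed.
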